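(* Let $k$ be a field, $P$ a polynomial ring in three variables over $k$, each variable of degree $1$. Let $f$ be a non-zero homogeneous element of $P$, $R=P/(f)$, and $a$ the $a$-invariant of $R$. Let $\mathcal I$ be a homogeneous grade three Gorenstein ideal in $P$, $b$ the back twist in the $P$-resolution of $P/\mathcal I$, and $J=\mathcal IR$. Let $$\mathbb F_\bullet:\quad \cdots \xrightarrow{d_4}\mathbb F_3\xrightarrow{d_3}\mathbb F_2\xrightarrow{d_2}\mathbb F_1\xrightarrow{d_1}R\to R/J\to 0$$ be the graded minimal $R$-resolution of $R/J$, and let $\{\sigma_i\mid 1\le i\le s\}$ be the socle degrees of $R/J$. Assume that (a) $\mathcal I$ and $J$ have the same number of minimal generators, (b) $\operatorname{rank}\mathbb F_2=\dim_k\operatorname{soc}(R/J)$, and (c) $\sigma_i+\sigma_j\neq b+2a$ for any pair $(i,j)$. Then there exist homogeneous alternating $s\times s$ matrices $\Phi$ and $\Psi$ with entries in $P$ such that $\Phi\Psi=f\cdot\mathrm{Id}_s=\Psi\Phi$ and $$\cdots\xrightarrow{\psi}\mathbb F_3(-|f|)\xrightarrow{\varphi}\mathbb F_2(-|f|)\xrightarrow{\psi}\mathbb F_3\xrightarrow{\varphi}\mathbb F_2\xrightarrow{d_2}\mathbb F_1\xrightarrow{d_1}R$$ is the minimal homogeneous resolution of $R/J$ by free $R$-modules, where $\varphi=\Phi\otimes_PR$ and $\psi=\Psi\otimes_PR$.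
   Context: The field $k$ has arbitrary characteristic. $|f|$ denotes the degree of $f$, and the $a$-invariant of $R=P/(f)$ is $a=|f|-3$. For a homogeneous Gorenstein ideal $\mathcal I$ of $P$ (i.e. $P/\mathcal I$ is Gorenstein), the last non-zero module in the minimal homogeneous free $P$-resolution of $P/\mathcal I$ equals $P(-b)$ for some integer $b$, called the back twist. $\operatorname{soc}(R/J)=(J:\mathfrak m)/J$, where $\mathfrak m$ is the irrelevant ideal of $R$; the socle degrees of $R/J$ are the degrees (with multiplicity) of the elements of a homogeneous $k$-basis of $\operatorname{soc}(R/J)$, so $s=\dim_k\operatorname{soc}(R/J)$. $M(n)$ denotes the graded module with $M(n)_j=M_{n+j}$. In (c), $i=j$ is allowed. A square matrix is alternating if it is skew-symmetric with zero diagonal. Under these hypotheses $\mathbb F_2\cong\bigoplus_{i=1}^sR(-(b+a-\sigma_i))$ and $\mathbb F_3\cong\bigoplus_{i=1}^sR(-(\sigma_i+3))$; the matrices act with respect to homogeneous bases of $\mathbb F_2$ and $\mathbb F_3$ (and the corresponding bases of their shifts), and ''homogeneous'' means that $\Phi:\bigoplus_iP(-(\sigma_i+3))\to\bigoplus_iP(-(b+a-\sigma_i))$ and $\Psi:\bigoplus_iP(-(b+a-\sigma_i)-|f|)\to\bigoplus_iP(-(\sigma_i+3))$ are degree-preserving maps. *)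

(* Defs.v *)
From HB Require Import structures.
From mathcomp Require Import all_boot all_order all_algebra.
From mathcomp Require Import mpoly.

Set Implicit Arguments.
Unset Strict Implicit.
Unset Printing Implicit Defensive.

Import GRing.Theory.
Local Open Scope ring_scope.

(* Rings are [comPzRingType]s, so that P/(f) may be the zero ring (this happens
   when f is a non-zero constant).  Ideals are [S -> Prop] predicates. *)

Section Ideals.
Variable S : comPzRingType.

Definition is_ideal (I : S -> Prop) : Prop :=
  [/\ I 0, forall x y, I x -> I y -> I (x + y) & forall c x, I x -> I (c * x)].

Definition ideal_gen (A : S -> Prop) (x : S) : Prop :=
  exists (n : nat) (c y : 'I_n -> S),
    (forall i, A (y i)) /\ x = \sum_(i < n) c i * y i.

Definition generated_by (n : nat) (g : 'I_n -> S) (I : S -> Prop) : Prop :=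
  forall x, I x <-> ideal_gen (fun y => exists i, y = g i) x.

Definition min_number_generators (I : S -> Prop) (n : nat) : Prop :=
  (exists g : 'I_n -> S, generated_by g I) /\
  (forall (m : nat) (g : 'I_m -> S), generated_by g I -> (n <= m)%N).

Definition colon (I J : S -> Prop) (x : S) : Prop :=
  forall y, J y -> I (x * y).

Definition regular_sequence (s : seq S) : Prop :=
  (forall i, (i < size s)%N -> forall y,
     ideal_gen (fun z => z \in take i s) (s`_i * y) ->
     ideal_gen (fun z => z \in take i s) y) /\
  ~ ideal_gen (fun z => z \in s) 1.

(* The grade of a proper ideal; the unit ideal has infinite grade. *)
Definition has_grade (I : S -> Prop) (n : nat) : Prop :=
  [/\ ~ I 1,
      exists s : seq S,
        [/\ size s = n, forall x, x \in s -> I x & regular_sequence s] &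
      forall s : seq S, (forall x, x \in s -> I x) -> regular_sequence s ->
        (size s <= n)%N].

End Ideals.

(* [pi] presents [S'] as the quotient ring S/I. *)
Definition is_quotient_map (S S' : comPzRingType) (pi : {rmorphism S -> S'})
    (I : S -> Prop) : Prop :=
  (forall r, exists p, pi p = r) /\ (forall p, pi p = 0 <-> I p).

Definition extended_ideal (S S' : comPzRingType) (pi : {rmorphism S -> S'})
    (I : S -> Prop) : S' -> Prop :=
  ideal_gen (fun r => exists2 p, I p & r = pi p).

Section Gorenstein.
Variable A : comNzRingType.

Definition injective_module (E : lmodType A) : Prop :=
  forall (M N : lmodType A) (i : {linear M -> N}) (g : {linear M -> E}),
    injective i -> exists h : {linear N -> E}, forall x, h (i x) = g x.

Fixpoint inj_dim_le (n : nat) (M : lmodType A) : Prop :=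
  if n isn't n'.+1 then injective_module M else
  exists (E C : lmodType A) (i : {linear M -> E}) (p : {linear E -> C}),
    [/\ injective_module E, inj_dim_le n' C, injective i,
        (forall c, exists x, p x = c) &
        (forall x, p x = 0 <-> exists m, i m = x)].

(* Finite self-injective dimension; for a Noetherian ring of finite Krull
   dimension this is equivalent to every localization at a prime ideal having
   finite self-injective dimension. *)
Definition gorenstein_ring : Prop := exists n, inj_dim_le n A^o.

End Gorenstein.

Definition gorenstein_ideal (S : comPzRingType) (I : S -> Prop) : Prop :=
  exists (A : comNzRingType) (pi : {rmorphism S -> A}),
    is_quotient_map pi I /\ gorenstein_ring A.

(* A Z-grading on S is given by its components: [gr d x] says that x belongs to
   the component of degree d (so [gr d 0] always holds). *)

Definition poly_gr (k : fieldType) (d : int) (p : {mpoly k[3]}) : Prop :=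
  if d is Posz n then p \is n.-homog else p = 0.

Definition quotient_gr (S S' : comPzRingType) (gr : int -> S -> Prop)
    (pi : {rmorphism S -> S'}) (d : int) (r : S') : Prop :=
  exists2 p, gr d p & r = pi p.

Section Graded.
Variables (S : comPzRingType) (gr : int -> S -> Prop).

Definition irrelevant_ideal : S -> Prop :=
  ideal_gen (fun x => exists d : int, 0 < d /\ gr d x).

Definition homogeneous_ideal (I : S -> Prop) : Prop :=
  is_ideal I /\ (forall x, I x -> ideal_gen (fun y => I y /\ exists d, gr d y) x).

(* Degree-preserving map (+)_j S(-u_j) -> (+)_i S(-t_i), acting on column
   vectors. *)
Definition homogeneous_mx (m n : nat) (t : 'I_m -> int) (u : 'I_n -> int)
    (M : 'M[S]_(m, n)) : Prop :=
  forall i j, gr (u j - t i) (M i j).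

Definition graded_iso (m n : nat) (t : 'I_m -> int) (u : 'I_n -> int)
    (B : 'M[S]_(m, n)) (C : 'M[S]_(n, m)) : Prop :=
  [/\ homogeneous_mx t u B, homogeneous_mx u t C,
      B *m C = 1%:M & C *m B = 1%:M].

End Graded.

(* A sequence of graded free modules F_n = (+)_i S(-(tw n i)), n >= 0, with
   maps df n : F_{n+1} -> F_n, i.e. [df n] is d_{n+1}. *)
Record free_seq (S : comPzRingType) := FreeSeq {
  rk : nat -> nat;
  tw : forall n, 'I_(rk n) -> int;
  df : forall n, 'M[S]_(rk n, rk n.+1)
}.
Arguments tw {S} _ n _.
Arguments df {S} _ n.

(* The conditions on F_0 say that F_0 = S and that the image of d_1 is J. *)
Definition minimal_graded_resolution (S : comPzRingType)
    (gr : int -> S -> Prop) (F : free_seq S) (J : S -> Prop) : Prop :=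
  [/\ rk F 0 = 1%N /\ (forall i, tw F 0%N i = 0),
      forall v : 'cV_(rk F 0),
        (forall i, J (v i 0)) <-> exists w, v = df F 0%N *m w,
      forall n (v : 'cV_(rk F n.+1)),
        df F n *m v = 0 <-> exists w, v = df F n.+1 *m w,
      forall n, homogeneous_mx gr (tw F n) (tw F n.+1) (df F n) &
      forall n i j, irrelevant_ideal gr (df F n i j)].

(* The last non-zero module of the minimal resolution of S/I is S(-b). *)
Definition back_twist (S : comPzRingType) (gr : int -> S -> Prop)
    (I : S -> Prop) (b : int) : Prop :=
  exists G : free_seq S, minimal_graded_resolution gr G I /\
  exists n, [/\ rk G n = 1%N, forall i, tw G n i = b &
                forall m, (n < m)%N -> rk G m = 0%N].

(* There is a homogeneous k-basis of (J : m)/J, represented by elements z_i of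
   (J : m), with z_i of degree sigma_i; [iota] is the structure map k -> S. *)
Definition socle_degrees (k : fieldType) (S : comPzRingType)
    (iota : {rmorphism k -> S}) (gr : int -> S -> Prop) (J : S -> Prop)
    (s : nat) (sigma : 'I_s -> int) : Prop :=
  exists z : 'I_s -> S,
    [/\ forall i, gr (sigma i) (z i),
        forall i, colon J (irrelevant_ideal gr) (z i) &
        forall x, colon J (irrelevant_ideal gr) x ->
          exists! c : 'rV[k]_s, J (x - \sum_i iota (c 0 i) * z i)].

Definition alternating_mx (S : comPzRingType) (n : nat) (M : 'M[S]_n) : Prop :=
  M^T = - M /\ forall i, M i i = 0.

(* ... -psi-> F_3(-e) -phi-> F_2(-e) -psi-> F_3 -phi-> F_2 -d_2-> F_1 -d_1-> F_0:
   for m >= 0 the module in position m+2 is F_2(-qe) if m = 2q and F_3(-qe) if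
   m = 2q+1. *)
Section PeriodicTail.
Variables (S : comPzRingType) (F : free_seq S) (e : int).
Variables (phi : 'M[S]_(rk F 2, rk F 3)) (psi : 'M[S]_(rk F 3, rk F 2)).

Definition periodic_rk (n : nat) : nat :=
  match n with
  | 0 => rk F 0
  | 1 => rk F 1
  | m.+2 => if odd m then rk F 3 else rk F 2
  end.

Definition periodic_tw (n : nat) : 'I_(periodic_rk n) -> int :=
  match n with
  | 0 => tw F 0%N
  | 1 => tw F 1%N
  | m.+2 =>
    if odd m as c return 'I_(if c then rk F 3 else rk F 2) -> int
    then fun i => tw F 3%N i + (m./2)%:Z * e
    else fun i => tw F 2%N i + (m./2)%:Z * e
  end.

Definition periodic_df (n : nat) : 'M[S]_(periodic_rk n, periodic_rk n.+1) :=
  match n with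
  | 0 => df F 0%N
  | 1 => df F 1%N
  | m.+2 =>
    if odd m as c
      return 'M[S]_(if c then rk F 3 else rk F 2, if ~~ c then rk F 3 else rk F 2)
    then psi else phi
  end.

Definition periodic_tail : free_seq S := FreeSeq periodic_tw periodic_df.

End PeriodicTail.

(* Main.v *)
(* Let P = k[x, y, z], let 0 -> P(-b) -h-> G_2 -X-> G_1 -g-> P be the minimal
   resolution of P/I, with its graded-commutative product.  As I and J have the
   same number of generators, F_2 -> F_1 lifts to a matrix C over P with columns
   c_i in G_1 and g C = f u.  Then u_i c_j - u_j c_i = X w_ij for some w_ij, and
     c_i c_j = f w_ij + h Psi_ij
   defines an alternating matrix Psi.  The product G_1 x G_2 -> G_3 is perfect
   (Buchsbaum-Eisenbud); this shows that C and Psi have the same kernel modulo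
   f, and, I having grade 3, that every linear form killing this kernel is
   modulo f a combination of rows of Psi.

   The relation module {v | C v in f G_1} has projective dimension 0 by Hilbert's
   syzygy theorem for (x, y, z), so it is spanned by the columns of a square
   matrix Phi0 with Phi0 Psi0 = f = Psi0 Phi0; comparing with the previous
   paragraph, Psi = E Psi0 with E invertible, and Phi = f Psi^(-1) has entries
   in P.  It is alternating because Phi Psi Phi = f Phi.

   This yields a P-free resolution of length 3 of R/J that ends with a module of
   rank s = dim soc(R/J), so the Koszul computation of Tor_3(R/J, k) gives a
   change of basis turning the degrees of F_2 into b + a - sigma_i.  Hypothesis
   (c) then says that Psi has no entry of degree 0, hence is minimal. *)
Require Import Defs.
From HB Require Import structures.
From mathcomp Require Import all_boot all_order all_algebra.
From mathcomp Require Import mpoly.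
From mathcomp Require Import ring.
From Stdlib Require Import Classical.

Set Implicit Arguments.
Unset Strict Implicit.
Unset Printing Implicit Defensive.

Import GRing.Theory.
Local Open Scope ring_scope.

(** * Matrices over a domain *)

Section FactorThrough.
Variables (T : Type) (S : comPzRingType).

Lemma mx_factor_cols a b p (D : 'M[S]_(a, b)) (V : 'M[S]_(a, p)) :
  (forall j, exists w : 'cV_b, col j V = D *m w) -> exists W, V = D *m W.
Proof.
move=> /fin_all_exists[w wE]; exists (\matrix_(i, j) w j i 0).
apply/matrixP=> i j; have /matrixP/(_ i 0) := wE j; rewrite !mxE => ->.
by apply: eq_bigr => l _; rewrite mxE.
Qed.

Lemma mx_factor_mod a b p f (D : 'M[S]_(a, b)) (V : 'M[S]_(a, p)) :
  (forall j, exists w t, col j V = D *m w + f *: t) ->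
  exists W T, V = D *m W + f *: T.
Proof.
move=> H; have [|Z ZE] := @mx_factor_cols _ _ _ (row_mx D f%:M) V.
  move=> j; have [w [t wt]] := H j.
  by exists (col_mx w t); rewrite mul_row_col mul_scalar_mx.
exists (usubmx Z), (dsubmx Z).
by rewrite ZE -[in LHS](vsubmxK Z) mul_row_col mul_scalar_mx.
Qed.

Lemma mx_entry_choose a b (Q : 'I_a -> 'I_b -> T -> Prop) :
  (forall i j, exists x, Q i j x) -> exists M : 'I_a -> 'I_b -> T,
  forall i j, Q i j (M i j).
Proof.
move=> H; have {}H i := fin_all_exists (H i).
by have [M MQ] := fin_all_exists H; exists M.
Qed.

End FactorThrough.

Lemma dvdmx_cols (S : comPzRingType) a b (f : S) (M : 'M[S]_(a, b)) :
  (forall j, exists y, col j M = f *: y) -> exists Y, M = f *: Y.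
Proof.
move=> /fin_all_exists[w wE]; exists (\matrix_(i, j) w j i 0).
by apply/matrixP=> i j; have /matrixP/(_ i 0) := wE j; rewrite !mxE.
Qed.

Section Domain.
Variable S : idomainType.

Lemma scalemxI a b (f : S) (A B : 'M[S]_(a, b)) :
  f != 0 -> f *: A = f *: B -> A = B.
Proof.
move=> f0 /matrixP H; apply/matrixP=> i j; have := H i j.
by rewrite !mxE; apply: mulfI.
Qed.

Lemma scalemx_eq0_inv a b (f : S) (A : 'M[S]_(a, b)) :
  f != 0 -> f *: A = 0 -> A = 0.
Proof. by move=> f0 H; apply: (scalemxI f0); rewrite H scaler0. Qed.

Lemma col_mul_row_eq0 p q (y : 'cV[S]_p) (g : 'rV[S]_q) :
  g != 0 -> y *m g = 0 -> y = 0.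
Proof.
move=> g0 H; apply/matrixP=> i j; rewrite !mxE ord1.
have [l gl] : exists l, g 0 l != 0.
  apply/existsP; move: g0; apply: contraNT; rewrite negb_exists => /forallP g0.
  by apply/eqP/rowP=> l; have := g0 l; rewrite negbK mxE => /eqP.
have /matrixP/(_ i l) := H; rewrite !mxE big_ord1 => /eqP.
by rewrite mulf_eq0 (negPf gl) orbF => /eqP.
Qed.

(** Multiplying by the adjugate turns [A *m (B *m A - f%:M) = 0] into
    [\det A *: (B *m A - f%:M) = 0], and [\det A] divides a power of [f], hence is non-zero. *)
Lemma mulmx_scalar_comm n (A B : 'M[S]_n) (f : S) :
  f != 0 -> A *m B = f%:M -> B *m A = f%:M.
Proof.
move=> f0 AB; have dA : \det A != 0.
  have : \det A * \det B != 0 by rewrite -det_mulmx AB det_scalar expf_neq0.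
  by rewrite mulf_eq0 negb_or => /andP[].
apply/eqP; rewrite -subr_eq0; apply/eqP/(scalemx_eq0_inv dA).
rewrite -mul_scalar_mx -mul_adj_mx -mulmxA mulmxBr !mulmxA AB.
by rewrite mul_scalar_mx mul_mx_scalar subrr mulmx0.
Qed.

(** In characteristic 2 skew-symmetry does not control the diagonal, so its vanishing is proved
    directly: the terms [(i, j)] and [(j, i)] cancel, and those with [i = j] are zero. *)
Lemma alternating_quad (n p : nat) (M : 'M[S]_n) (A : 'M[S]_(n, p)) :
  alternating_mx M -> alternating_mx (A^T *m M *m A).
Proof.
case=> MT Md; split.
  by rewrite !trmx_mul trmxK MT mulNmx mulmxN mulmxA.
have Ms i j : M j i = - M i j.
  by have /matrixP/(_ i j) := MT; rewrite !mxE.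
move=> l; rewrite mxE.
under eq_bigr do rewrite mxE big_distrl /=.
rewrite pair_big /= (bigID (fun x : 'I_n * 'I_n => (x.1 < x.2)%N)) /=.
rewrite [X in _ + X](bigID (fun x : 'I_n * 'I_n => (x.2 < x.1)%N)) /=.
rewrite [X in _ + (_ + X)]big1 ?addr0; last first.
  case=> i j /= /andP[]; rewrite -!leqNgt => ij ji.
  have -> : i = j by apply/val_inj/anti_leq/andP.
  by rewrite Md mulr0 mul0r.
rewrite [X in _ + X](reindex_inj (h := fun x => (x.2, x.1))) /=; last first.
  by case=> a b [c d] [-> ->].
rewrite [X in _ + X](eq_bigl (fun x : 'I_n * 'I_n => (x.1 < x.2)%N)); last first.
  by case=> i j /=; case: ltngtP.
rewrite -big_split big1 //= => -[i j] /= _.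
by rewrite !mxE (Ms j i); ring.
Qed.

End Domain.

(** Solutions are chosen for [i < j] only and extended by sign, which yields a zero diagonal in
    every characteristic. *)
Lemma alternating_choice (V : zmodType) n (Q : 'I_n -> 'I_n -> V -> Prop) :
  (forall i j x, Q i j x -> Q j i (- x)) -> (forall i, Q i i 0) ->
  (forall i j, exists x, Q i j x) ->
  exists M : 'I_n -> 'I_n -> V,
    [/\ forall i j, Q i j (M i j), forall i j, M j i = - M i j &
        forall i, M i i = 0].
Proof.
move=> Qs Q0 /mx_entry_choose[N NQ].
exists (fun i j : 'I_n => if (i < j)%N then N i j else if (j < i)%N then - N j i else 0).
split.
- move=> i j; case: ltngtP => // ij; first exact: Qs.
  by have -> : i = j by apply/val_inj.
- by move=> i j; case: ltngtP; rewrite ?opprK ?oppr0.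
- by move=> i; rewrite ltnn.
Qed.

(** * Exactness and regular sequences *)

Definition exact_mx (S : comPzRingType) a b c (D : 'M[S]_(a, b)) (D' : 'M[S]_(b, c)) :=
  D *m D' = 0 /\ forall v : 'cV_b, D *m v = 0 -> exists w, v = D' *m w.

Lemma exact_mxP (S : comPzRingType) a b c p (D : 'M[S]_(a, b)) (D' : 'M[S]_(b, c)) :
  exact_mx D D' -> forall V : 'M_(b, p), D *m V = 0 -> exists W, V = D' *m W.
Proof.
move=> [_ ex] V DV; apply: mx_factor_cols => j; apply: ex.
by rewrite colE mulmxA DV mul0mx.
Qed.

Section Regular3.
Variable S : idomainType.

Definition regular3 (x y z : S) : Prop :=
  [/\ x != 0, forall q r, y * q = x * r -> exists t, q = x * t &
      forall q r t, z * q = x * r + y * t -> exists u v, q = x * u + y * v].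

Variables x y z : S.
Hypothesis reg : regular3 x y z.

Lemma regular3_neq0 : x != 0. Proof. by case: reg. Qed.

Lemma regular3_mx2 a b (A B : 'M_(a, b)) :
  y *: A = x *: B -> exists C, A = x *: C.
Proof.
case: reg => _ yreg _ AB.
have [i j|C CE] := @mx_entry_choose S a b (fun i j c => A i j = x * c).
  by have /matrixP/(_ i j) := AB; rewrite !mxE; apply: yreg.
by exists (\matrix_(i, j) C i j); apply/matrixP=> i j; rewrite !mxE.
Qed.

Lemma regular3_mx3 a b (A B C : 'M_(a, b)) :
  z *: A = x *: B + y *: C -> exists D E, A = x *: D + y *: E.
Proof.
case: reg => _ _ zreg ABC; have [i j|C' CE] :=
    @mx_entry_choose (S * S) a b (fun i j c => A i j = x * c.1 + y * c.2).
  have /matrixP/(_ i j) := ABC; rewrite !mxE => /zreg[u [v ->]].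
  by exists (u, v).
exists (\matrix_(i, j) (C' i j).1), (\matrix_(i, j) (C' i j).2).
by apply/matrixP=> i j; rewrite !mxE.
Qed.

End Regular3.

(** * Kernels modulo a regular sequence *)

Section Syzygy.
Variables (S : idomainType) (x y z : S) (a b c d : nat).
Variables (D1 : 'M[S]_(a, b)) (D2 : 'M[S]_(b, c)) (D3 : 'M[S]_(c, d)).
Hypotheses (reg : regular3 x y z) (ex12 : exact_mx D1 D2) (ex23 : exact_mx D2 D3).

(** Kernel vectors modulo [x] lift: [x] cancels from [x *: (D *m u) = 0], exactness gives
    [u = D' *m t], and [v - x *: t] is in the kernel. *)
Let lift_kernel1 a' b' c' (D : 'M[S]_(a', b')) (D' : 'M[S]_(b', c')) v u :
  exact_mx D D' -> D' *m v = x *: u ->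
  exists w t : 'cV_c', D' *m w = 0 /\ v = w + x *: t.
Proof.
move=> ex D'v; have : x *: (D *m u) = 0.
  by rewrite scalemxAr -D'v mulmxA ex.1 mul0mx.
move/(scalemx_eq0_inv (regular3_neq0 reg))/ex.2 => [t ut].
exists (v - x *: t), t; rewrite subrK mulmxBr D'v ut scalemxAr subrr.
by split.
Qed.

(** Lifting from the kernel modulo [(x, y)] uses two exact places: one rewrites [u'] modulo [x], the
    other removes the remaining multiple of [x]. *)
Let lift_kernel2 v u u' : D3 *m v = x *: u + y *: u' ->
  exists w t t' : 'cV_d, D3 *m w = 0 /\ v = w + x *: t + y *: t'.
Proof.
move=> D3v; have /(regular3_mx2 reg)[q qE] : y *: (D2 *m u') = x *: (- (D2 *m u)).
  have : D2 *m (D3 *m v) = 0 by rewrite mulmxA ex23.1 mul0mx.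
  rewrite D3v mulmxDr -!scalemxAr scalerN addrC => /eqP.
  by rewrite addr_eq0 => /eqP.
have [w [t [D2w u'E]]] := lift_kernel1 ex12 qE.
have [r rE] := ex23.2 _ D2w.
have [|w' [t' [D3w' vE]]] := @lift_kernel1 _ _ _ D2 D3 (v - y *: r) (u + y *: t) ex23.
  rewrite mulmxBr D3v u'E -scalemxAr -rE !scalerDr !scalerA addrA addrAC addrK.
  by rewrite mulrC.
by exists w', t', r; split => //; rewrite -vE subrK.
Qed.

(* [Tor_4(-, S/(x, y, z)) = 0] for the complex with last map [D3]. *)
Lemma third_syzygy_pure (q v0 v1 v2 : 'cV_d) : D3 *m q = 0 ->
  q = x *: v0 + y *: v1 + z *: v2 -> exists w0 w1 w2 : 'cV_d,
  [/\ D3 *m w0 = 0, D3 *m w1 = 0, D3 *m w2 = 0 &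
      q = x *: w0 + y *: w1 + z *: w2].
Proof.
move=> D3q qE.
have : z *: (D3 *m v2) = x *: (- (D3 *m v0)) + y *: (- (D3 *m v1)).
  apply/eqP; rewrite !scalerN -opprD -addr_eq0 addrC !scalemxAr -!mulmxDr -qE.
  exact/eqP.
(* The coefficients are corrected in turn: [v2] modulo [(x, y)], then [v1] modulo [x]; what remains
   is a multiple of [x], and [x] cancels. *)
case/(regular3_mx3 reg)=> [r0 [r1 /lift_kernel2[w2 [t0 [t1 [D3w2 v2E]]]]]].
have qE2 : q - z *: w2 = x *: (v0 + z *: t0) + y *: (v1 + z *: t1).
  rewrite qE v2E !scalerDr !scalerA [x * z]mulrC [y * z]mulrC.
  by apply/matrixP=> i j; rewrite !mxE; ring.
have D3qw2 : D3 *m (q - z *: w2) = 0.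
  by rewrite mulmxBr D3q -scalemxAr D3w2 scaler0 subr0.
have : y *: (D3 *m (v1 + z *: t1)) = x *: (- (D3 *m (v0 + z *: t0))).
  apply/eqP; rewrite scalerN -addr_eq0 addrC !scalemxAr -!mulmxDr -qE2.
  exact/eqP.
case/(regular3_mx2 reg)=> r2 /(lift_kernel1 ex23)[w1 [t [D3w1 v1E]]].
have qE1 : q - z *: w2 - y *: w1 = x *: (v0 + z *: t0 + y *: t).
  rewrite qE2 v1E !scalerDr !scalerA [y * x]mulrC.
  by apply/matrixP=> i j; rewrite !mxE; ring.
exists (v0 + z *: t0 + y *: t), w1, w2; split=> //.
  apply: (scalemx_eq0_inv (regular3_neq0 reg)); rewrite scalemxAr -qE1 mulmxBr D3qw2.
  by rewrite -scalemxAr D3w1 scaler0 subr0.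
by rewrite -qE1 !subrK.
Qed.

End Syzygy.

(** * Exactness of the dual complex *)

Section Dual.
Variables (S : idomainType) (n m p : nat).
Variables (g : 'rV[S]_n) (X : 'M[S]_(n, m)) (h : 'M[S]_(m, p)).
Hypotheses (gX : exact_mx g X) (Xh : exact_mx X h).

(** An element of the ideal kills the cokernel of [g], so multiplication by it is null-homotopic on
    the resolution; [H0], [H1], [H2] are the components of a homotopy. *)
Lemma mul_nullhomotopic x (H0 : 'cV_n) : g *m H0 = x%:M ->
  exists H1 H2, x%:M = H0 *m g + X *m H1 /\ x%:M = H1 *m X + h *m H2.
Proof.
move=> gH0; have [H1 H1E] : exists H1, x%:M - H0 *m g = X *m H1.
  apply: (exact_mxP gX); rewrite mulmxBr mulmxA gH0.
  by rewrite mul_mx_scalar mul_scalar_mx subrr.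
have [H2 H2E] : exists H2, x%:M - H1 *m X = h *m H2.
  apply: (exact_mxP Xh); rewrite mulmxBr mulmxA -H1E mulmxBl -mulmxA gX.1 mulmx0.
  by rewrite subr0 mul_mx_scalar mul_scalar_mx subrr.
by exists H1, H2; rewrite -H1E -H2E ![_ + (_ - _)]addrC !subrK.
Qed.

Variables x y z : S.
Hypotheses (xI : exists w, g *m w = x%:M) (yI : exists w, g *m w = y%:M).
Hypotheses (zI : exists w, g *m w = z%:M) (reg : regular3 x y z).

(* [Ext^1(S/I, S) = 0] *)
Lemma dual_exact1 : exact_mx X^T g^T.
Proof.
split=> [|v Xv]; first by rewrite -trmx_mul gX.1 trmx0.
have vX : v^T *m X = 0 by rewrite -[X]trmxK -trmx_mul Xv trmx0.
have [H0 gH0] := xI; have [H1 [H2 [E1 _]]] := mul_nullhomotopic gH0.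
have xv : x *: v^T = v^T *m H0 *m g.
  by rewrite -mul_mx_scalar E1 mulmxDr !mulmxA vX mul0mx addr0.
have [w gw] := yI.
have : y *: (v^T *m H0) = x *: (v^T *m w).
  by rewrite -mul_mx_scalar -gw mulmxA -xv -scalemxAl.
case/(regular3_mx2 reg)=> q qE; exists q^T; rewrite -trmx_mul -[LHS]trmxK; congr trmx.
by apply: (scalemxI (regular3_neq0 reg)); rewrite xv qE scalemxAl.
Qed.

(* [Ext^2(S/I, S) = 0] *)
Lemma dual_exact2 : exact_mx h^T X^T.
Proof.
split=> [|v hv]; first by rewrite -trmx_mul Xh.1 trmx0.
have vh : v^T *m h = 0 by rewrite -[h]trmxK -trmx_mul hv trmx0.
have [H0 gH0] := xI; have [H1 [H2 [_ E2]]] := mul_nullhomotopic gH0.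
have xv : x *: v^T = v^T *m H1 *m X.
  by rewrite -mul_mx_scalar E2 mulmxDr !mulmxA vh mul0mx addr0.
have [K0 gK0] := yI; have [K1 [K2 [F1 _]]] := mul_nullhomotopic gK0.
(* Here [x *: v^T = t *m X]. Regularity of [z] and then of [y] changes [t] by a multiple of [g],
   which [X] kills, into a multiple of [x]. *)
set t := v^T *m H1 in xv; set t' := t *m K0.
have yt : y *: t = t' *m g + x *: (v^T *m K1).
  by rewrite -mul_mx_scalar F1 mulmxDr !mulmxA -xv -scalemxAl.
have [w gw] := zI.
have : z *: t' = y *: (t *m w) - x *: (v^T *m K1 *m w).
  rewrite -mul_mx_scalar -gw mulmxA; apply/(canRL (addrK _)).
  by rewrite scalemxAl -mulmxDl -yt -scalemxAl.
rewrite addrC -scalerN => /(regular3_mx3 reg)[A [B tAB]].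
have : y *: (t - B *m g) = x *: (A *m g + v^T *m K1).
  rewrite scalerBr yt tAB mulmxDl !scalemxAl scalerDr !scalemxAl.
  by rewrite -addrA addrC -!addrA [X in _ + X]addrC !addrA addrK addrC.
case/(regular3_mx2 reg)=> N /(canRL (subrK _)) NE; exists N^T.
rewrite -trmx_mul -[LHS]trmxK; congr trmx; apply: (scalemxI (regular3_neq0 reg)).
by rewrite xv NE mulmxDl -mulmxA gX.1 mulmx0 addr0 scalemxAl.
Qed.

End Dual.

(** * The product on a length three Gorenstein resolution *)

Section Multiplication.
Variables (S : idomainType) (n m : nat).
Variables (g : 'rV[S]_n) (X : 'M[S]_(n, m)) (h : 'cV[S]_m).
Hypotheses (gX : exact_mx g X) (Xh : exact_mx X h).
Hypotheses (gXt : exact_mx X^T g^T) (Xht : exact_mx h^T X^T).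
Hypotheses (g0 : g != 0) (h0 : h != 0).

Let e_ l : 'rV[S]_m := delta_mx 0 l.

Lemma mul_hrow l : e_ l *m h = (h l 0)%:M.
Proof. by rewrite -rowE; apply/matrixP=> i j; rewrite !mxE !ord1. Qed.

(* Contracting the dual complex along multiplication by an entry of [h]. *)
Lemma last_syzygy_in_ideal : exists U : 'M_(n, m), g *m U = h^T.
Proof.
suff /fin_all_exists[U UE] : forall l, exists U : 'cV_n, g *m U = (h l 0)%:M.
  exists (\matrix_(i, l) U l i 0); apply/matrixP=> i l; rewrite !mxE ord1.
  have /matrixP/(_ 0 0) := UE l; rewrite !mxE mulr1n => <-.
  by apply: eq_bigr => j _; rewrite mxE.
(* [e_ l], [A1] and [A2] form a homotopy for multiplication by [h l 0] on the dual complex; its last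
   component [A2] is the required column. *)
move=> l; have [A1 A1E] : exists A, (h l 0)%:M - h *m e_ l = A *m X.
  have [|W WE] := exact_mxP Xht (V := ((h l 0)%:M - h *m e_ l)^T).
    rewrite -trmx_mul mulmxBl -mulmxA mul_hrow mul_scalar_mx mul_mx_scalar.
    by rewrite subrr trmx0.
  by exists W^T; rewrite -[LHS]trmxK WE trmx_mul trmxK.
have [A2 A2E] : exists A, (h l 0)%:M - X *m A1 = A *m g.
  have [|W WE] := exact_mxP gXt (V := ((h l 0)%:M - X *m A1)^T).
    rewrite -trmx_mul mulmxBl -mulmxA -A1E mulmxBr mulmxA Xh.1 mul0mx subr0.
    by rewrite mul_scalar_mx mul_mx_scalar subrr trmx0.
  by exists W^T; rewrite -[LHS]trmxK WE trmx_mul trmxK.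
exists A2; apply/eqP; rewrite -subr_eq0; apply/eqP/(col_mul_row_eq0 g0).
rewrite mulmxBl -mulmxA -A2E mulmxBr mulmxA gX.1 mul0mx subr0.
by rewrite mul_scalar_mx mul_mx_scalar subrr.
Qed.

(* [M l i j] is the [l]-th coordinate of the product of the [i]-th and [j]-th
   degree one generators of the algebra structure on the resolution. *)
Lemma product11 : exists M : 'I_m -> 'M[S]_n, (forall l, alternating_mx (M l)) /\
  forall a i j, \sum_l X a l * M l i j = (g 0 i *+ (a == j) - g 0 j *+ (a == i)).
Proof.
have [|i|i j|N [NE Ns Nd]] := @alternating_choice 'cV[S]_m n (fun i j x =>
    forall a, (X *m x) a 0 = g 0 i *+ (a == j) - g 0 j *+ (a == i)).
- by move=> i j x xE a; rewrite mulmxN mxE xE opprB.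
- by move=> a; rewrite mulmx0 mxE subrr.
- have [|x xE] := gX.2 (\col_a (g 0 i *+ (a == j) - g 0 j *+ (a == i))).
    apply/matrixP=> a b; rewrite !ord1 !mxE.
    under eq_bigr do rewrite mxE mulrBr !mulrnAr.
    rewrite sumrB (bigD1 j) //= big1 ?eqxx ?addr0; last first.
      by move=> l /negPf->.
    rewrite (bigD1 i) //= big1 ?eqxx ?addr0; last by move=> l /negPf->.
    by rewrite mulr1n mulrC subrr.
  by exists x => a; rewrite -xE mxE.
exists (fun l => \matrix_(i, j) N i j l 0); split=> [l|a i j].
  split=> [|i]; last by rewrite mxE Nd mxE.
  by apply/matrixP=> i j; rewrite !mxE Ns mxE.
by rewrite -NE mxE; apply: eq_bigr => l _; rewrite mxE.
Qed.

Section WithProduct.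
Variable M : 'I_m -> 'M[S]_n.
Hypothesis Malt : forall l, alternating_mx (M l).
Hypothesis ME : forall a i j,
  \sum_l X a l * M l i j = (g 0 i *+ (a == j) - g 0 j *+ (a == i)).

(** [T i k] is the product of the i-th generator of degree one and the k-th of degree two. The
    Leibniz rule prescribes its differential, which is a cycle for [X] and hence a multiple of
    [h]. *)
Lemma product12 : exists T : 'M[S]_(n, m),
  forall l, h l 0 *: T = g^T *m e_ l - M l *m X.
Proof.
suff /fin_all_exists[T TE] : forall i, exists T : 'rV[S]_m,
    forall l k, h l 0 * T 0 k = g 0 i *+ (k == l) - (M l *m X) i k.
  exists (\matrix_(i, k) T i 0 k) => l; apply/matrixP=> i k.
  by rewrite !mxE TE !mxE big_ord1 !mxE eqxx mulr_natr.
move=> i; pose V := \matrix_(l, k) (g 0 i *+ (k == l) - (M l *m X) i k).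
have [|T TE] := exact_mxP Xh (V := V).
  apply/matrixP=> a k; rewrite !mxE.
  under eq_bigr do rewrite mxE mulrBr mulrnAr.
  rewrite sumrB (bigD1 k) //= big1 ?eqxx ?addr0; last first.
    by move=> l /negPf lk; rewrite eq_sym lk.
  under [X in _ - X]eq_bigr do rewrite mxE mulr_sumr.
  rewrite exchange_big /=.
  under [X in _ - X]eq_bigr do
    (under eq_bigr do rewrite mulrA; rewrite -mulr_suml ME mulrBl).
  rewrite sumrB (bigD1 a) //= big1 ?eqxx ?addr0; last first.
    by move=> j /negPf ja; rewrite eq_sym ja mulr0n mul0r.
  rewrite !mulr1n [g 0 i * _]mulrC opprB addrCA subrr addr0.
  under eq_bigr do rewrite mulrnAl.
  case: eqP => _; last by rewrite big1.
  by have /matrixP/(_ 0 k) := gX.1; rewrite !mxE.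
exists T => l k; have /matrixP/(_ l k) := TE.
by rewrite !mxE big_ord1 => <-.
Qed.

(** This is the Leibniz rule for a degree one generator times the last generator, a product that is
    zero by degree; formally a non-zero entry of [h] is cancelled. *)
Lemma product12_last T : (forall l, h l 0 *: T = g^T *m e_ l - M l *m X) ->
  T *m h = g^T.
Proof.
move=> TE; have /existsP[l hl] : [exists l, h l 0 != 0].
  move: h0; apply: contraNT; rewrite negb_exists => /forallP h0'.
  by apply/eqP/colP=> l; have := h0' l; rewrite negbK mxE => /eqP.
apply: (scalemxI hl); rewrite scalemxAl TE mulmxBl -!mulmxA Xh.1 mulmx0 subr0.
by rewrite mul_hrow mul_mx_scalar.
Qed.

End WithProduct.
End Multiplication.

(** * The alternating matrix Psi *)

Section Factorization.
Variables (S : idomainType) (n m s : nat) (f : S).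
Variables (g : 'rV[S]_n) (X : 'M[S]_(n, m)) (h : 'cV[S]_m).
Hypotheses (f0 : f != 0) (g0 : g != 0).
Hypotheses (gX : exact_mx g X) (Xh : exact_mx X h).
Hypotheses (gXt : exact_mx X^T g^T) (Xht : exact_mx h^T X^T).
Variables (M : 'I_m -> 'M[S]_n) (T : 'M[S]_(n, m)) (T' : 'M[S]_(m, n)).
Hypothesis Malt : forall l, alternating_mx (M l).
Hypothesis ME : forall a i j,
  \sum_l X a l * M l i j = (g 0 i *+ (a == j) - g 0 j *+ (a == i)).
Hypothesis TE : forall l, h l 0 *: T = g^T *m delta_mx 0 l - M l *m X.
Hypotheses (Th : T *m h = g^T) (TT' : T *m T' = 1%:M).
Variables (C : 'M[S]_(n, s)) (u : 'rV[S]_s).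
Hypothesis gC : g *m C = f *: u.
Hypothesis Cgen : forall (y : 'cV_n) q, g *m y = f *: q ->
  exists v w, y = C *m v + f *: w.

Lemma cyclesE p (Y : 'M_(n, p)) q : g *m Y = f *: q ->
  exists V W, Y = C *m V + f *: W.
Proof.
move=> gY; apply: mx_factor_mod => j; apply: (Cgen (q := col j q)).
by rewrite [col j Y]colE mulmxA gY -scalemxAl -colE.
Qed.

(** No non-zero class modulo [f] is killed by all entries of [g]: cancelling [f] gives [k *m X = 0],
    so [k] is a multiple of [g] by exactness of the dual complex. *)
Lemma dvd_of_ideal y k : y *: g = f *: k -> exists q, y = f * q.
Proof.
move=> yg; have : f *: (k *m X) = 0.
  by rewrite scalemxAl -yg -scalemxAl gX.1 scaler0.
move/(scalemx_eq0_inv f0) => kX; have [|w wE] := gXt.2 k^T.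
  by rewrite -trmx_mul kX trmx0.
exists (w 0 0); apply/eqP; rewrite -subr_eq0.
have : (y - f * w 0 0)%:M *m g = 0 :> 'rV_n.
  rewrite mul_scalar_mx scalerBl yg -scalerA -scalerBr.
  have -> : k = w^T *m g by rewrite -[k]trmxK wE trmx_mul trmxK.
  rewrite [w^T]mx11_scalar mul_scalar_mx mxE.
  by rewrite subrr scaler0.
by move/(col_mul_row_eq0 g0)/matrixP/(_ 0 0); rewrite !mxE mulr1n => ->.
Qed.

Lemma dvdmx_of_ideal a b (K : 'I_n -> 'M_(a, b)) Y :
  (forall i, g 0 i *: Y = f *: K i) -> exists Z, Y = f *: Z.
Proof.
move=> YK; have [i j|Z ZE] := @mx_entry_choose S a b (fun i j q => Y i j = f * q).
  apply: (@dvd_of_ideal _ (\row_l K l i j)); apply/rowP=> l; rewrite !mxE.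
  by have /matrixP/(_ i j) := YK l; rewrite !mxE mulrC.
by exists (\matrix_(i, j) Z i j); apply/matrixP=> i j; rewrite !mxE.
Qed.

(** By [Th], the entries of [g] are combinations of those of [h]. *)
Lemma dvdmx_of_last a b (K : 'I_m -> 'M_(a, b)) Y :
  (forall l, h l 0 *: Y = f *: K l) -> exists Z, Y = f *: Z.
Proof.
move=> YK; apply: (@dvdmx_of_ideal _ _ (fun i => \sum_l T i l *: K l)) => i.
have -> : g 0 i = \sum_l T i l * h l 0.
  by have /matrixP/(_ i 0) := Th; rewrite !mxE.
rewrite scaler_suml scaler_sumr; apply: eq_bigr => l _.
by rewrite -scalerA YK !scalerA mulrC.
Qed.

Lemma psi_exists : exists (Psi : 'M[S]_s) (W : 'I_m -> 'M[S]_s),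
  alternating_mx Psi /\
  forall l, h l 0 *: Psi = C^T *m M l *m C - f *: W l.
Proof.
have Balt l := alternating_quad C (Malt l).
(* An entry of [Psi] and its correction [w] are chosen as a pair, because one equation ties them
   together. *)
have [|i|i j|N [NE Ns Nd]] := @alternating_choice (S * 'cV[S]_m)%type s
  (fun i j x => forall l, h l 0 * x.1 = (C^T *m M l *m C) i j - f * x.2 l 0).
- move=> i j [p w] /= E l; have /matrixP/(_ i j) := (Balt l).1.
  rewrite [LHS]mxE [RHS]mxE => ->; rewrite mulrN E [(- w) _ _]mxE; ring.
- by move=> l; rewrite (Balt l).2 /= mxE !mulr0 subrr.
- have [|w wE] := gX.2 (u 0 i *: col j C - u 0 j *: col i C).
    rewrite mulmxBr -!scalemxAr !colE !mulmxA gC.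
    apply/matrixP=> a b; rewrite !ord1 -!scalemxAl -!colE !mxE; ring.
  have [|p pE] := Xh.2 (\col_l ((C^T *m M l *m C) i j - f * w l 0)).
    have -> : \col_l ((C^T *m M l *m C) i j - f * w l 0) =
      (\col_l (C^T *m M l *m C) i j) - f *: w.
      by apply/colP=> l; rewrite !mxE.
    rewrite mulmxBr -scalemxAr -wE; apply/colP=> a; rewrite !mxE.
    (* [ME] evaluates [X] on the product of two columns of [C]: two Kronecker sums survive, and [gC]
       makes each a multiple of [f]. *)
    under eq_bigr do rewrite !mxE mulr_sumr.
    rewrite exchange_big /=.
    under eq_bigr => x _.
      under eq_bigr => l _.
        rewrite mxE mulr_suml mulr_sumr.
        under eq_bigr do rewrite mxE.
        over.
      rewrite exchange_big /=.
      under eq_bigr => y _.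
        under eq_bigr => l _.
          have -> : X a l * (C y i * M l y x * C x j) =
            (X a l * M l y x) * (C y i * C x j) by ring.
          over.
        rewrite -mulr_suml ME mulrBl.
        over.
      rewrite sumrB.
      over.
    rewrite sumrB (bigD1 a) //= [X in _ + X - _ - _]big1 ?addr0; last first.
      by move=> x /negPf xa; rewrite big1 // => y _; rewrite eq_sym xa mulr0n mul0r.
    rewrite [X in _ - X - _]exchange_big [X in _ - X - _](bigD1 a) //= [X in _ - (_ + X) - _]big1 ?addr0; last first.
      by move=> x /negPf xa; rewrite big1 // => y _; rewrite eq_sym xa mulr0n mul0r.
    rewrite eqxx; have gCi l : \sum_y g 0 y * C y l = f * u 0 l.
      by have /matrixP/(_ 0 l) := gC; rewrite !mxE.
    under eq_bigr do rewrite mulr1n mulrA.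
    under [X in _ - X - _]eq_bigr do rewrite mulr1n mulrCA mulrC.
    rewrite -!mulr_suml !gCi; ring.
  exists (p 0 0, w) => l /=; have /matrixP/(_ l 0) := pE.
  by rewrite !mxE big_ord1 => ->.
exists (\matrix_(i, j) (N i j).1), (fun l => \matrix_(i, j) (N i j).2 l 0).
split=> [|l].
  by split=> [|i]; [apply/matrixP=> i j; rewrite !mxE Ns | rewrite mxE Nd].
by apply/matrixP=> i j; have := NE i j l; rewrite !mxE.
Qed.

Section WithPsi.
Variables (Psi : 'M[S]_s) (W : 'I_m -> 'M[S]_s).
Hypothesis Psialt : alternating_mx Psi.
Hypothesis PsiE : forall l, h l 0 *: Psi = C^T *m M l *m C - f *: W l.

(** Modulo [f], each entry of [h] times [Psi *m v] is [C^T *m M l *m C *m v], which vanishes;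
    [dvdmx_of_last] removes the entries of [h]. *)
Lemma psi_of_C p (v : 'M_(s, p)) y : C *m v = f *: y ->
  exists z, Psi *m v = f *: z.
Proof.
move=> Cv; apply: (@dvdmx_of_last _ _
  (fun l => C^T *m M l *m y - W l *m v)) => l.
by rewrite scalemxAl PsiE mulmxBl -!mulmxA Cv scalerBr -!scalemxAr -scalemxAl.
Qed.

(** The columns of [X] are cycles, so [X = C *m A + f *: D]. Multiplying [TE] by [C^T] gives [h l 0
    *: (C^T *m T) = - h l 0 *: (Psi *m A)] modulo [f], and [h l 0] is removed. *)
Lemma psi_factor : exists (A : 'M_(s, m)) (B : 'M_(s, m)),
  C^T *m T = - (Psi *m A) + f *: B.
Proof.
have [|A [D AD]] := @cyclesE _ X 0; first by rewrite gX.1 scaler0.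
have [|B BE] := @dvdmx_of_last _ _
  (fun l => u^T *m delta_mx 0 l - C^T *m M l *m D - W l *m A)
  (C^T *m T + Psi *m A); last first.
  by exists A, B; rewrite -BE addrC addrK.
move=> l; rewrite scalerDr scalemxAr TE scalemxAl PsiE.
rewrite mulmxBr mulmxA -trmx_mul gC linearZ /= -scalemxAl AD.
rewrite mulmxDr mulmxBl -!scalemxAl -!scalemxAr !mulmxDr !mulmxA -!scalemxAr !scalerBr opprD !mulmxA.
by apply/matrixP=> i j; rewrite !mxE; ring.
Qed.

(** Perfectness of the pairing, in the form [TT'], removes [T] from [psi_factor]; the transpose of
    [Psi] is [- Psi]. *)
Lemma C_factor : exists (A : 'M_(n, s)) (B : 'M_(n, s)),
  C = A *m Psi + f *: B.
Proof.
have [A [B AB]] := psi_factor; exists (T'^T *m A^T), (T'^T *m B^T).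
rewrite -[LHS]trmxK -[C^T]mulmx1 -TT' mulmxA AB trmx_mul linearD linearN /=.
rewrite trmx_mul Psialt.1 mulmxN opprK [(f *: B)^T]linearZ /=.
by rewrite mulmxDr mulmxA scalemxAr.
Qed.

Lemma C_of_psi p (v : 'M_(s, p)) z : Psi *m v = f *: z ->
  exists y, C *m v = f *: y.
Proof.
move=> Pv; have [A [B ->]] := C_factor; exists (A *m z + B *m v).
by rewrite mulmxDl -mulmxA Pv scalerDr -scalemxAr -scalemxAl.
Qed.

(* A functional on the module generated by the columns of [C] modulo [f]
   extends to the ambient free module after multiplication by an element of the
   ideal; as the ideal has grade at least 2 modulo [f], one can divide again. *)
Lemma functional_psi (q : 'rV[S]_s) :
  (forall v y : 'cV_ _, C *m v = f *: y -> exists z, q *m v = f *: z) ->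
  exists w t, q = w *m Psi + f *: t.
Proof.
move=> Hq; have Hqm p (v : 'M_(s, p)) y : C *m v = f *: y ->
    exists z, q *m v = f *: z.
  move=> Cv; apply: dvdmx_cols => j; rewrite colE -mulmxA.
  by apply: (Hq _ (y *m delta_mx j 0)); rewrite mulmxA Cv scalemxAl.
have [A [B CAB]] := C_factor.
(* The columns of [(g 0 i)%:M - delta_mx i 0 *m g] are cycles, hence equal to [C *m V] modulo [f].
   Then [V *m C] acts as [g 0 i] up to the kernel of [C] modulo [f], so [q *m V] extends
   [g 0 i *: q]. *)
have /fin_all_exists[th thE] : forall i, exists th : 'rV_s, exists k : 'rV_s,
    g 0 i *: q = th *m Psi + f *: k.
  move=> i; have [|V [D VD]] := @cyclesE _ ((g 0 i)%:M - delta_mx i 0 *m g) 0.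
    rewrite mulmxBr mulmxA -colE mul_mx_scalar scaler0.
    apply/rowP=> j; rewrite !mxE big_ord1 !mxE; ring.
  have CV : C *m (V *m C - (g 0 i)%:M) =
      f *: (- (D *m C) - delta_mx i 0 *m u).
    rewrite mulmxBr mulmxA -(addrK (f *: D) (C *m V)) -VD.
    rewrite mul_mx_scalar !mulmxBl mul_scalar_mx -!mulmxA gC.
    rewrite scalerBr -scalemxAr scalerN -scalemxAl.
    by apply/matrixP=> a b; rewrite !mxE; ring.
  have [z zE] := Hqm _ _ _ CV.
  exists (q *m V *m A), (q *m V *m B - z).
  have -> : g 0 i *: q = q *m V *m C - f *: z.
    by rewrite -zE mulmxBr mul_mx_scalar mulmxA opprB addrC subrK.
  by rewrite {1}CAB mulmxDr mulmxA -scalemxAr scalerBr addrA.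
have [k kE] := fin_all_exists thE => {thE}.
pose P := \matrix_(i, j) th i 0 j.
pose K := \matrix_(i, j) k i 0 j.
have PE : g^T *m q = P *m Psi + f *: K.
  apply/row_matrixP => i; rewrite row_mul.
  have -> : row i g^T = (g 0 i)%:M by apply/matrixP=> a b; rewrite !ord1 !mxE mulr1n.
  rewrite mul_scalar_mx kE linearD /= row_mul linearZ /=.
  by congr (_ *m _ + f *: _); apply/rowP=> j; rewrite !mxE.
(* Modulo [f], columns [i] and [l] of [H] agree after multiplication by [g 0 l] and [g 0 i]: [Psi]
   is skew-symmetric, and [C] kills what [Psi] kills. *)
pose H := C *m P^T.
have HE i l : exists d, g 0 l *: col i H - g 0 i *: col l H = f *: d.
  have [|y yE] := @C_of_psi _ (g 0 l *: (row i P)^T - g 0 i *: (row l P)^T)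
    (g 0 l *: row i K - g 0 i *: row l K)^T; last first.
    by exists y; rewrite -yE mulmxBr -!scalemxAr !tr_row !colE !mulmxA.
  have E : (g 0 l *: row i P - g 0 i *: row l P) *m Psi =
      - f *: (g 0 l *: row i K - g 0 i *: row l K).
    rewrite mulmxBl -!scalemxAl -!row_mul.
    have -> : P *m Psi = g^T *m q - f *: K by rewrite PE addrK.
    by apply/matrixP=> a b; rewrite !mxE !big_ord1 !mxE; ring.
  rewrite -[LHS]trmxK trmx_mul Psialt.1 mulmxN linearB /=.
  by rewrite ![(_ *: _^T)^T]linearZ /= !trmxK E scaleNr opprK linearZ.
(* Each row of [H] kills [X] modulo [f], so exactness at two places of the dual complex makes it a
   multiple of [g] modulo [f]. *)
have [y [w Hy]] : exists y w, H = y *m g + f *: w.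
  suff /fin_all_exists[y0 /fin_all_exists[w0 yE]] : forall a, exists y : S,
      exists w : 'rV_n, row a H = y *: g + f *: w.
    exists (\col_a y0 a), (\matrix_(a, i) w0 a 0 i).
    apply/matrixP=> a i; have /rowP/(_ i) := yE a.
    by rewrite !mxE big_ord1 !mxE.
  move=> a; have [x xE] : exists x, row a H *m X = f *: x.
    have [i l|d dE] := @mx_entry_choose S n n (fun i l d =>
        g 0 l * H a i - g 0 i * H a l = f * d).
      have [d /matrixP/(_ a 0)] := HE i l; rewrite !mxE => dE.
      by exists (d a 0).
    apply: (@dvdmx_of_ideal _ _ (fun i => - ((\row_l d i l) *m X))) => i.
    rewrite scalemxAl scalerN scalemxAl; apply/eqP; rewrite -addr_eq0 -mulmxDl.
    have -> : g 0 i *: row a H + f *: (\row_l d i l) = H a i *: g.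
      apply/rowP=> l; rewrite !mxE -dE !mxE; ring.
    by rewrite -scalemxAl gX.1 scaler0.
  have [|w wE] := Xht.2 x^T.
    rewrite -trmx_mul; apply/eqP; rewrite trmx_eq0; apply/eqP.
    by apply: (scalemx_eq0_inv f0); rewrite scalemxAl -xE -mulmxA Xh.1 mulmx0.
  have [|z zE] := gXt.2 (row a H - f *: w^T)^T.
    rewrite -trmx_mul mulmxBl xE -scalemxAl.
    have -> : x = w^T *m X by rewrite -[x]trmxK wE trmx_mul trmxK.
    by rewrite subrr trmx0.
  exists (z 0 0), w^T; apply/eqP; rewrite -subr_eq; apply/eqP.
  rewrite -[LHS]trmxK zE trmx_mul trmxK [z^T]mx11_scalar mul_scalar_mx.
  by rewrite mxE.
(* [g *m H] is divisible by [f] because [g *m C] is; comparison with [y *m g] shows that [g *m y] is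
   divisible too, so [Cgen] applies to [y]. *)
have [gy gyE] : exists gy, g *m y = f *: gy.
  apply: (@dvdmx_of_ideal _ _ (fun i => col i (u *m P^T - g *m w))) => i.
  have : g *m H = g *m y *m g + f *: (g *m w) by rewrite Hy mulmxDr mulmxA scalemxAr.
  rewrite /H mulmxA gC -scalemxAl => E.
  have /rowP/(_ i) := E => {}E; apply/matrixP=> a b; rewrite !ord1.
  move: E; rewrite !mxE big_ord1 mulrBr => ->; rewrite !mxE; ring.
have [v [x yE]] := Cgen gyE.
have [|z zE] := @psi_of_C _ (P^T - v *m g) (x *m g + w).
  rewrite mulmxBr -/H Hy yE mulmxA mulmxDl scalerDr scalemxAl.
  by apply/matrixP=> a b; rewrite !mxE; ring.
(* By transposition, [P *m Psi] is [g^T *m v^T *m Psi] modulo [f]; it remains to cancel [g^T]. *)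
have : g^T *m (q - v^T *m Psi) = f *: (K - z^T).
  rewrite mulmxBr PE scalerBr -[f *: z^T]linearZ /= -zE trmx_mul linearB /=.
  rewrite trmxK trmx_mul Psialt.1 mulmxN mulmxBl !mulmxA.
  by apply/matrixP=> a b; rewrite !mxE; ring.
move=> E; have [|t tE] := @dvdmx_of_ideal _ _ (fun i => row i (K - z^T))
    (q - v^T *m Psi).
  move=> i; have /row_matrixP/(_ i) := E; rewrite row_mul linearZ /= => <-.
  have -> : row i g^T = (g 0 i)%:M by apply/matrixP=> a b; rewrite !ord1 !mxE mulr1n.
  by rewrite mul_scalar_mx.
by exists v^T, t; rewrite -tE addrC subrK.
Qed.

End WithPsi.
End Factorization.

(** * Polynomials in three variables *)

Section Variables.
Variables (k : fieldType) (N : nat).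
Local Notation P := {mpoly k[N]}.
Implicit Types (p q r : P) (A : pred 'I_N).

Definition avoids A (m : 'X_{1..N}) := [forall i, A i ==> (m i == 0%N)].

Lemma mcoeffXM_eq0 (i : 'I_N) (m : 'X_{1..N}) p : m i = 0%N -> ('X_i * p)@_m = 0.
Proof.
move=> mi; rewrite mcoeffM big1 // => -[k1 k2] /= /eqP mE; rewrite mcoeffX.
case: eqP => [k1E|]; last by rewrite mul0r.
by have /mnmP/(_ i) := mE; rewrite mi -k1E mnmDE mnm1E eqxx.
Qed.

(** A monomial either is divisible by a variable of [A] or avoids [A]; [r] is the normal form modulo
    these variables. *)
Lemma variables_split A p : exists (q : 'I_N -> P) r,
  p = \sum_(i | A i) 'X_i * q i + r /\ forall m, r@_m != 0 -> avoids A m.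
Proof.
elim/mpolyind: p => [|c m p _ _ [q [r [-> rA]]]].
  exists (fun=> 0), 0; rewrite addr0 big1 => [|i _]; last by rewrite mulr0.
  by split=> // m; rewrite mcoeff0 eqxx.
have [mA|] := boolP (avoids A m).
  exists q, (c *: 'X_[m] + r); rewrite addrCA; split=> // m'.
  rewrite mcoeffD mcoeffZ mcoeffX; have [<- //|_] := eqVneq m m'.
  by rewrite mulr0 add0r => /rA.
rewrite negb_forall => /existsP[i]; rewrite negb_imply => /andP[Ai mi].
exists (fun j => (if j == i then c *: 'X_[m - U_(i)] else 0) + q j), r.
split=> //; rewrite addrA; congr (_ + _).
under [RHS]eq_bigr do rewrite mulrDr.
rewrite big_split /=; congr (_ + _); rewrite (bigD1 i) //= eqxx big1 => [|j].
  rewrite addr0 -scalerAr -mpolyXD addmC submK //.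
  by rewrite lep1mP.
by case/andP=> _ /negPf->; rewrite mulr0.
Qed.

(** If [m] occurs in [r], then [m + U_(j)] occurs in ['X_j * r] and still avoids [A], unlike every
    monomial of the ideal generated by the variables of [A]. *)
Lemma variable_regular A j r : ~~ A j -> (forall m, r@_m != 0 -> avoids A m) ->
  (exists s : 'I_N -> P, 'X_j * r = \sum_(i | A i) 'X_i * s i) -> r = 0.
Proof.
move=> Aj rA [s E]; apply/mpolyP=> m; rewrite mcoeff0; apply/eqP.
apply: contraT => rm; have /forallP mA := rA _ rm.
have : ('X_j * r)@_(m + U_(j)) = 0.
  rewrite E raddf_sum /= big1 // => i Ai; apply: mcoeffXM_eq0.
  have /implyP/(_ Ai)/eqP mi := mA i; rewrite mnmDE mi mnm1E.
  by case: eqP => // ji; rewrite ji Ai in Aj.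
by rewrite mulrC addmC mcoeffMX => r0; rewrite r0 eqxx in rm.
Qed.

Lemma variable_nzd A j q : ~~ A j ->
  (exists s : 'I_N -> P, 'X_j * q = \sum_(i | A i) 'X_i * s i) ->
  exists t : 'I_N -> P, q = \sum_(i | A i) 'X_i * t i.
Proof.
move=> Aj [s E]; have [t [r [qE rA]]] := variables_split A q.
exists t; rewrite qE (variable_regular Aj rA) ?addr0 //.
exists (fun i => s i - 'X_j * t i).
under eq_bigr do rewrite mulrBr.
rewrite sumrB -E qE mulrDr mulr_sumr addrAC.
rewrite [X in X - _ + _](_ : _ = \sum_(i | A i) 'X_i * ('X_j * t i)).
  by rewrite subrr add0r.
by apply: eq_bigr => i _; rewrite mulrCA.
Qed.

Lemma irrelevant_variables p : p@_0 = 0 -> exists q : 'I_N -> P, p = \sum_i 'X_i * q i.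
Proof.
move=> p0; have [q [r [pE rA]]] := variables_split predT p.
exists q; rewrite pE; suff -> : r = 0 by rewrite addr0.
apply/mpolyP=> m; rewrite mcoeff0; apply/eqP; apply: contraT => rm.
have m0 : m = 0%MM.
  by apply/mnmP=> i; have /forallP/(_ i)/= /eqP := rA _ rm; rewrite mnm0E.
move: p0; rewrite pE mcoeffD raddf_sum /= big1 => [|i _].
  by rewrite add0r -m0 => r0; rewrite r0 eqxx in rm.
by apply: mcoeffXM_eq0; rewrite mnm0E.
Qed.

(** Membership in the d-th power of the irrelevant ideal, read off the coefficients. *)
Definition order_ge d p := forall m, (mdeg m < d)%N -> p@_m = 0.

Lemma order_geXM d i p : order_ge d p -> order_ge d.+1 ('X_i * p).
Proof.
move=> pd m md; rewrite mcoeffM big1 // => -[k1 k2] /= /eqP mE; rewrite mcoeffX.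
case: eqP => [k1E|]; last by rewrite mul0r.
rewrite pd ?mulr0 //; have /(congr1 mdeg) := mE.
by rewrite mdegD -k1E mdeg1 add1n => mdE; rewrite mdE ltnS in md.
Qed.

Lemma order_geD d p q : order_ge d p -> order_ge d q -> order_ge d (p + q).
Proof. by move=> pd qd m md; rewrite mcoeffD pd // qd // addr0. Qed.

Lemma order_ge_eq0 p : (forall d, order_ge d p) -> p = 0.
Proof. by move=> H; apply/mpolyP=> m; rewrite mcoeff0; apply: (H (mdeg m).+1). Qed.

End Variables.

Section ThreeVariables.
Variable k : fieldType.
Local Notation P := {mpoly k[3]}.

Definition mvar0 : P := 'X_(@Ordinal 3 0 isT).
Definition mvar1 : P := 'X_(@Ordinal 3 1 isT).
Definition mvar2 : P := 'X_(@Ordinal 3 2 isT).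

Lemma sum_ord3 (F : 'I_3 -> P) :
  \sum_i F i = F (@Ordinal 3 0 isT) + F (@Ordinal 3 1 isT) + F (@Ordinal 3 2 isT).
Proof.
rewrite !big_ord_recl big_ord0 addr0 addrA.
by congr (F _ + F _ + F _); apply/val_inj.
Qed.

Lemma variables_regular3 : regular3 mvar0 mvar1 mvar2.
Proof.
split=> [|q r E|q r t E].
- by apply/eqP=> /mpolyP/(_ U_(@Ordinal 3 0 isT))%MM /eqP; rewrite mcoeffX eqxx mcoeff0 oner_eq0.
- have [//||t tE] := @variable_nzd k 3 (pred1 (@Ordinal 3 0 isT)) (@Ordinal 3 1 isT) q.
    by exists (fun=> r); rewrite big_pred1_eq.
  by exists (t (@Ordinal 3 0 isT)); rewrite tE big_pred1_eq.
- have sumE (F : 'I_3 -> P) : \sum_(i : 'I_3 | (i < 2)%N) F i =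
      F (@Ordinal 3 0 isT) + F (@Ordinal 3 1 isT).
    by rewrite big_mkcond /= sum_ord3 /= addr0.
  have [//||s sE] := @variable_nzd k 3 (fun i => (i < 2)%N) (@Ordinal 3 2 isT) q.
    by exists (fun i => if (i == 0 :> nat)%N then r else t); rewrite sumE.
  by exists (s (@Ordinal 3 0 isT)), (s (@Ordinal 3 1 isT)); rewrite sE sumE.
Qed.

Lemma irrelevant3 (p : P) : p@_0 = 0 -> exists q0 q1 q2, p = mvar0 * q0 + mvar1 * q1 + mvar2 * q2.
Proof.
move=> /irrelevant_variables[q ->]; rewrite sum_ord3.
by exists (q (@Ordinal 3 0 isT)), (q (@Ordinal 3 1 isT)), (q (@Ordinal 3 2 isT)).
Qed.

Lemma irrelevant3_mx a b (M : 'M[P]_(a, b)) : map_mx (mcoeff 0%MM) M = 0 ->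
  exists M0 M1 M2, M = mvar0 *: M0 + mvar1 *: M1 + mvar2 *: M2.
Proof.
move=> M0; have [i j|Q QE] := @mx_entry_choose (P * P * P) a b (fun i j q =>
    M i j = mvar0 * q.1.1 + mvar1 * q.1.2 + mvar2 * q.2).
  have /irrelevant3[q0 [q1 [q2 ->]]] : (M i j)@_0 = 0.
    by have /matrixP/(_ i j) := M0; rewrite !mxE.
  by exists (q0, q1, q2).
exists (\matrix_(i, j) (Q i j).1.1), (\matrix_(i, j) (Q i j).1.2), (\matrix_(i, j) (Q i j).2).
by apply/matrixP=> i j; rewrite !mxE QE.
Qed.

(* Krull intersection: by [third_syzygy_pure], the kernel [Z] satisfies [Z = m Z]. *)
Lemma third_syzygy_inj a b c d (D1 : 'M[P]_(a, b)) (D2 : 'M[P]_(b, c))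
    (D3 : 'M[P]_(c, d)) : exact_mx D1 D2 -> exact_mx D2 D3 ->
  (forall v : 'cV_d, D3 *m v = 0 -> map_mx (mcoeff 0%MM) v = 0) ->
  forall v : 'cV_d, D3 *m v = 0 -> v = 0.
Proof.
move=> ex12 ex23 minD v D3v; apply/matrixP=> i j; rewrite mxE.
apply: order_ge_eq0 => o; elim: o v D3v => [//|o IHo] v D3v in i j *.
have [v0 [v1 [v2 vE]]] := irrelevant3_mx (minD _ D3v).
have [w0 [w1 [w2 [D0 D1' D2' ->]]]] :=
  third_syzygy_pure variables_regular3 ex12 ex23 D3v vE.
rewrite !mxE; do 2?[apply: order_geD]; apply: order_geXM; exact: IHo.
Qed.

End ThreeVariables.

(** * Graded matrices *)

Section Grading.
Variable k : fieldType.
Local Notation P := {mpoly k[3]}.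
Local Notation gr := (@poly_gr k).
Implicit Types (p q : P) (d : int).

Lemma poly_grP d p : gr d p <-> forall m, p@_m != 0 -> (mdeg m)%:Z = d.
Proof.
rewrite /poly_gr; case: d => [d|d]; split.
- by move=> pd m; apply: contraNeq => md; rewrite (dhomog_nemf_coeff pd).
- move=> H; apply/dhomogP=> m; rewrite mcoeff_msupp => /H.
  by case.
- by move=> -> m; rewrite mcoeff0 eqxx.
- move=> H; apply/mpolyP=> m; rewrite mcoeff0; apply/eqP.
  by apply: contraT => /H.
Qed.

Definition hcomp d p : P := if d is Posz n then pihomog mdeg n p else 0.

Lemma mcoeff_hcomp d p m : (hcomp d p)@_m = if (mdeg m)%:Z == d then p@_m else 0.
Proof.
case: d => [d|d]; last by rewrite /= mcoeff0.
rewrite /hcomp pihomogE raddf_sum /= eqz_nat.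
under eq_bigr do rewrite mcoeffZ mcoeffX.
have [mp|mp] := boolP (m \in msupp p); last first.
  rewrite big1_seq ?memN_msupp_eq0 ?if_same // => m' /andP[_ m'p].
  by case: eqP => [m'm|]; [rewrite -m'm m'p in mp | rewrite mulr0].
rewrite big_mkcond (bigD1_seq m) ?msupp_uniq //= eqxx mulr1 big1 ?addr0 //.
by move=> m' /negPf->; rewrite mulr0 if_same.
Qed.

Lemma hcomp_gr d p : gr d (hcomp d p).
Proof. by apply/poly_grP=> m; rewrite mcoeff_hcomp; case: ifP => [/eqP //|_]; rewrite eqxx. Qed.

Lemma hcomp_id d p : gr d p -> hcomp d p = p.
Proof.
move/poly_grP=> pd; apply/mpolyP=> m; rewrite mcoeff_hcomp.
by case: eqP => // md; apply/esym/eqP; apply: contraT => /pd.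
Qed.

Lemma hcomp_is_linear d : linear (hcomp d).
Proof.
move=> c p q; apply/mpolyP=> m.
by rewrite mcoeffD mcoeffZ !mcoeff_hcomp mcoeffD mcoeffZ; case: eqP; rewrite ?mulr0 ?addr0.
Qed.

HB.instance Definition _ d := GRing.isLinear.Build k P P _ (hcomp d) (hcomp_is_linear d).

Lemma hcompM d d' p q : gr d p -> hcomp (d + d') (p * q) = p * hcomp d' q.
Proof.
move/poly_grP=> pd; apply/mpolyP=> m; rewrite mcoeff_hcomp !mcoeffM.
rewrite (fun_if (fun x => x = _)).
under [X in _ = X]eq_bigr do rewrite mcoeff_hcomp.
case: eqP => mE; [apply: eq_bigr|rewrite big1 //] => -[k1 k2] /= /eqP mk.
  have E : (mdeg m)%:Z = (mdeg k1)%:Z + (mdeg k2)%:Z by rewrite {1}mk mdegD PoszD.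
  have [->|/pd dk1] := eqVneq p@_k1 0; first by rewrite !mul0r.
  case: eqP => // dk2; case: dk2; apply: (addrI d).
  by rewrite -mE -dk1 -E.
have [->|/pd dk1] := eqVneq p@_k1 0; first by rewrite !mul0r.
rewrite mcoeff_hcomp; case: eqP => [dk2|_]; last by rewrite mulr0.
by case: mE; rewrite {1}mk mdegD PoszD dk1 dk2.
Qed.

Lemma gr0 d : gr d 0.
Proof. by apply/poly_grP=> m; rewrite mcoeff0 eqxx. Qed.

Lemma gr_sum d (I : Type) (r : seq I) (A : pred I) (F : I -> P) :
  (forall i, A i -> gr d (F i)) -> gr d (\sum_(i <- r | A i) F i).
Proof.
move=> H; have <- : hcomp d (\sum_(i <- r | A i) F i) = \sum_(i <- r | A i) F i.
  by rewrite raddf_sum; apply: eq_bigr => i /H /hcomp_id.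
exact: hcomp_gr.
Qed.

Lemma grD d p q : gr d p -> gr d q -> gr d (p + q).
Proof. by move=> pd qd; rewrite -(hcomp_id pd) -(hcomp_id qd) -raddfD; apply: hcomp_gr. Qed.

Lemma grN d p : gr d p -> gr d (- p).
Proof. by move=> pd; rewrite -(hcomp_id pd) -raddfN; apply: hcomp_gr. Qed.

Lemma grM d d' p q : gr d p -> gr d' q -> gr (d + d') (p * q).
Proof. by move=> pd qd; rewrite -(hcomp_id qd) -(hcompM _ _ pd); apply: hcomp_gr. Qed.

Lemma grC c : gr 0 c%:MP.
Proof.
apply/poly_grP=> m; rewrite mcoeffC; have [->|_] := eqVneq m 0%MM; first by rewrite mdeg0.
by rewrite mulr0 eqxx.
Qed.

Lemma gr_mcoeff0 d p : gr d p -> d != 0 -> p@_0%MM = 0.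
Proof.
move/poly_grP=> pd /eqP d0; apply/eqP; apply: contraT => /pd.
by rewrite mdeg0 => /esym.
Qed.

Lemma hcomp0 p : hcomp 0 p = (p@_0%MM)%:MP.
Proof.
apply/mpolyP=> m; rewrite mcoeff_hcomp mcoeffC eqz_nat mdeg_eq0.
by case: eqP => [->|]; rewrite ?mulr1 ?mulr0.
Qed.

Lemma hcomp_mulr d p q : gr d p -> hcomp d (q * p) = (q@_0%MM)%:MP * p.
Proof. by move=> pd; rewrite mulrC -[d in hcomp d]addr0 (hcompM _ _ pd) hcomp0 mulrC. Qed.

Local Notation hmx := (homogeneous_mx gr).
Local Notation cst := (map_mx (@mcoeff 3 k 0%MM)).

(** The degree-preserving part of an arbitrary matrix; it turns solutions of homogeneous linear
    systems into homogeneous solutions. *)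
Definition hcompmx m n (t : 'I_m -> int) (u : 'I_n -> int) (M : 'M[P]_(m, n)) :=
  \matrix_(i, j) hcomp (u j - t i) (M i j).

Lemma hcompmxP m n t u (M : 'M_(m, n)) : hmx t u (hcompmx t u M).
Proof. by move=> i j; rewrite mxE; apply: hcomp_gr. Qed.

Lemma hcompmx_id m n t u (M : 'M_(m, n)) : hmx t u M -> hcompmx t u M = M.
Proof. by move=> hM; apply/matrixP=> i j; rewrite mxE hcomp_id. Qed.

Lemma hmx_eq m n (t t' : 'I_m -> int) (u u' : 'I_n -> int) (M : 'M_(m, n)) :
  (forall i j, u j - t i = u' j - t' i) -> hmx t u M -> hmx t' u' M.
Proof. by move=> E hM i j; rewrite -E. Qed.

Lemma hmxD m n (t : 'I_m -> int) (u : 'I_n -> int) A B :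
  hmx t u A -> hmx t u B -> hmx t u (A + B).
Proof. by move=> hA hB i j; rewrite mxE; apply: grD. Qed.

Lemma hmxN m n (t : 'I_m -> int) (u : 'I_n -> int) A : hmx t u A -> hmx t u (- A).
Proof. by move=> hA i j; rewrite mxE; apply: grN. Qed.

Lemma hmxM m n o (t : 'I_m -> int) (u : 'I_n -> int) (v : 'I_o -> int) A B :
  hmx t u A -> hmx u v B -> hmx t v (A *m B).
Proof.
move=> hA hB i j; rewrite mxE; apply: gr_sum => l _.
by rewrite (_ : _ - _ = u l - t i + (v j - u l)); [apply: grM|ring].
Qed.

Lemma hmx_tr m n (t : 'I_m -> int) (u : 'I_n -> int) A :
  hmx t u A -> hmx (fun j => - u j) (fun i => - t i) A^T.
Proof. by move=> hA i j; rewrite mxE opprK addrC. Qed.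

Lemma hmxZ m n d (t : 'I_m -> int) (u : 'I_n -> int) c A :
  gr d c -> hmx t u A -> hmx (fun i => t i - d) u (c *: A).
Proof.
move=> cd hA i j; rewrite mxE (_ : _ - _ = d + (u j - t i)); first exact: grM.
by ring.
Qed.

Lemma hmx1 m (t : 'I_m -> int) : hmx t t 1%:M.
Proof.
move=> i j; rewrite mxE; case: eqP => [->|_]; last exact: gr0.
by rewrite subrr -mpolyC1; apply: grC.
Qed.

Lemma hmx_row_mx m n1 n2 (t : 'I_m -> int) (u : 'I_(n1 + n2) -> int) A B :
  hmx t (fun j => u (lshift n2 j)) A -> hmx t (fun j => u (rshift n1 j)) B ->
  hmx t u (row_mx A B).
Proof.
move=> hA hB i j; rewrite mxE; case: split_ordP => l jE; rewrite jE.
  exact: hA.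
exact: hB.
Qed.

Lemma hcompmxMl m n o (t : 'I_m -> int) (u : 'I_n -> int) (v : 'I_o -> int) A B :
  hmx t u A -> hcompmx t v (A *m B) = A *m hcompmx u v B.
Proof.
move=> hA; apply/matrixP=> i j; rewrite !mxE raddf_sum; apply: eq_bigr => l _ /=.
rewrite mxE -(hcompM _ _ (hA i l)); congr (hcomp _ _); ring.
Qed.

Lemma hcompmxD m n (t : 'I_m -> int) (u : 'I_n -> int) A B :
  hcompmx t u (A + B) = hcompmx t u A + hcompmx t u B.
Proof. by apply/matrixP=> i j; rewrite !mxE raddfD. Qed.

Lemma hcompmxZ m n d (t : 'I_m -> int) (u : 'I_n -> int) c A :
  gr d c -> hcompmx t u (c *: A) = c *: hcompmx (fun i => t i + d) u A.
Proof.
move=> cd; apply/matrixP=> i j; rewrite !mxE -(hcompM _ _ cd); congr (hcomp _ _); ring.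
Qed.

Lemma homog_factor m n o (t : 'I_m -> int) (u : 'I_n -> int) (v : 'I_o -> int) D V :
  hmx t u D -> hmx t v V -> (exists W, V = D *m W) ->
  exists2 W, hmx u v W & V = D *m W.
Proof.
move=> hD hV [W E]; exists (hcompmx u v W); first exact: hcompmxP.
by rewrite -(hcompmxMl _ _ hD) -E hcompmx_id.
Qed.

Lemma homog_factor_mod m n o d f (t : 'I_m -> int) (u : 'I_n -> int) (v : 'I_o -> int)
  D V : gr d f -> hmx t u D -> hmx t v V ->
  (exists W Z, V = D *m W + f *: Z) -> exists W Z,
  [/\ hmx u v W, hmx (fun i => t i + d) v Z & V = D *m W + f *: Z].
Proof.
move=> fd hD hV [W [Z E]]; exists (hcompmx u v W), (hcompmx (fun i => t i + d) v Z).
split; [exact: hcompmxP|exact: hcompmxP|].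
by rewrite -(hcompmxMl _ _ hD) -(hcompmxZ _ _ _ fd) -hcompmxD -E hcompmx_id.
Qed.

(* Taking components of the degrees of [V], only the constant term of [q] survives. *)
Lemma homog_factor_unit m n o (t : 'I_m -> int) (u : 'I_n -> int) (v : 'I_o -> int)
    D V q : hmx t u D -> hmx t v V -> q@_0%MM != 0 ->
  (exists W, q *: V = D *m W) -> exists2 W, hmx u v W & V = D *m W.
Proof.
move=> hD hV q0 [W E]; apply: homog_factor => //.
exists (((q@_0%MM)^-1)%:MP *: hcompmx u v W).
rewrite -scalemxAr -(hcompmxMl _ _ hD) -E; apply/matrixP=> i j; rewrite !mxE.
by rewrite hcomp_mulr // mulrA -mpolyCM mulVf // mul1r.
Qed.

Lemma cstM m n o (A : 'M[P]_(m, n)) (B : 'M_(n, o)) : cst (A *m B) = cst A *m cst B.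
Proof. exact: map_mxM. Qed.

Lemma det_cst n (A : 'M[P]_n) : (\det A)@_0%MM = \det (cst A).
Proof. by rewrite det_map_mx. Qed.

(** A form of Nakayama's lemma: [B *m \adj (A *m B)] is a right inverse of [A] up to the factor
    [\det (A *m B)], whose constant term is 1. *)
Lemma homog_right_inverse m n (t : 'I_m -> int) (u : 'I_n -> int)
    (A : 'M[P]_(m, n)) (B : 'M[P]_(n, m)) :
  hmx t u A -> cst A *m cst B = 1%:M -> exists2 A', hmx u t A' & A *m A' = 1%:M.
Proof.
move=> hA AB; have [||A' hA' E] := @homog_factor_unit _ _ _ t u t A 1%:M (\det (A *m B)) hA (hmx1 t).
- by rewrite det_cst cstM AB det1 oner_eq0.
- by exists (B *m \adj (A *m B)); rewrite mulmxA mul_mx_adj scalemx1.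
by exists A'.
Qed.

Lemma homog_inverse m n (t : 'I_m -> int) (u : 'I_n -> int)
    (A : 'M[P]_(m, n)) (B : 'M[P]_(n, m)) :
  hmx t u A -> cst A *m cst B = 1%:M -> cst B *m cst A = 1%:M ->
  exists A', [/\ hmx u t A', A *m A' = 1%:M & A' *m A = 1%:M].
Proof.
move=> hA AB BA; have [A' hA' AA'] := homog_right_inverse hA AB.
have [|B' _ /(congr1 trmx)] := homog_right_inverse (B := B^T) (hmx_tr hA).
  by rewrite -!map_trmx -trmx_mul BA trmx1.
rewrite trmx_mul trmxK trmx1 => B'A; exists A'; split=> //.
suff -> : A' = B'^T by [].
by rewrite -[A']mul1mx -B'A -mulmxA AA' mulmx1.
Qed.

(** While some relation between the columns has an entry with non-zero constant term, that column is
    redundant and is dropped. *)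
Lemma minimal_homog_generators n r (t : 'I_n -> int) (u : 'I_r -> int) (D : 'M_(n, r)) :
  hmx t u D -> exists r' (u' : 'I_r' -> int) (D' : 'M_(n, r')),
  [/\ hmx t u' D', exists A, D = D' *m A, exists B, D' = D *m B &
      forall v : 'cV_r', D' *m v = 0 -> cst v = 0].
Proof.
elim: r u D => [|r IHr] u D hD.
  exists 0, u, D; split=> //; try by exists 1%:M; rewrite mulmx1.
  by move=> v _; apply/matrixP=> -[].
have [[v [i [Dv vi]]]|H] := classic (exists (v : 'cV[P]_r.+1) i, D *m v = 0 /\ (v i 0)@_0%MM != 0); last first.
  exists r.+1, u, D; split=> //; try by exists 1%:M; rewrite mulmx1.
  move=> v Dv; apply/matrixP=> i j; rewrite !mxE ord1; apply/eqP.
  by apply: contraT => vi; case: H; exists v, i.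
(* The component of the relation in the degree of column [i] has a non-zero constant as i-th entry,
   so it can be solved for that column. *)
pose w := hcompmx u (fun _ : 'I_1 => u i) v.
have Dw : D *m w = 0.
  by rewrite -(hcompmxMl _ _ hD) Dv; apply/matrixP=> a b; rewrite !mxE raddf0.
have wi : w i 0 = ((v i 0)@_0%MM)%:MP by rewrite mxE subrr hcomp0.
have Dsum o (z : 'M_(r.+1, o)) : D *m z = col i D *m row i z + col' i D *m row' i z.
  apply/matrixP=> a b; rewrite !mxE (bigD1_ord i) //= big_ord1 !mxE; congr (_ + _).
  by apply: eq_bigr => l _; rewrite !mxE.
have hcol : hmx t (fun j => u (lift i j)) (col' i D) by move=> a b; rewrite mxE.
have [r' [u' [D' [hD' [A AE] [B BE] minD']]]] := IHr _ _ hcol.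
exists r', u', D'; split=> //; last first.
  exists (\matrix_(a, b) (if unlift i a is Some l then B l b else 0)).
  rewrite Dsum (_ : row i _ = 0) ?mulmx0 ?add0r; last first.
    by apply/matrixP=> a b; rewrite !mxE unlift_none.
  rewrite BE; congr (_ *m _).
  by apply/matrixP=> a b; rewrite !mxE liftK.
pose c := ((v i 0)@_0%MM)^-1.
have colE : col i D = col' i D *m (- c%:MP *: row' i w).
  move: Dw; rewrite Dsum; have -> : row i w = ((v i 0)@_0%MM)%:MP%:M.
    by apply/matrixP=> a b; rewrite !ord1 -wi !mxE mulr1n.
  rewrite mul_mx_scalar => /eqP; rewrite addr_eq0 => /eqP Ew.
  rewrite scaleNr mulmxN -scalemxAr -scalerN -Ew scalerA -mpolyCM mulVf //.
  by rewrite scale1r.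
exists (A *m (- c%:MP *: row' i w *m row i 1%:M + row' i 1%:M)).
by rewrite mulmxA -AE mulmxDr mulmxA -colE -Dsum mulmx1.
Qed.

End Grading.

(** * Homogeneous products and homogeneous Psi *)

Section GradedAlgebra.
Variable k : fieldType.
Local Notation P := {mpoly k[3]}.
Local Notation gr := (@poly_gr k).
Local Notation hmx := (homogeneous_mx gr).
Local Notation cst := (map_mx (@mcoeff 3 k 0%MM)).

Variables (n m : nat) (u1 : 'I_n -> int) (u2 : 'I_m -> int) (b : int).
Variables (g : 'rV[P]_n) (X : 'M[P]_(n, m)) (h : 'cV[P]_m).
Hypotheses (hg : hmx (fun=> 0) u1 g) (hX : hmx u1 u2 X) (hh : hmx u2 (fun=> b) h).
Hypotheses (g0 : g != 0) (h0 : h != 0) (X0 : cst X = 0).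
Hypotheses (gX : exact_mx g X) (Xh : exact_mx X h).
Hypotheses (gXt : exact_mx X^T g^T) (Xht : exact_mx h^T X^T).

Lemma homog_product11 : exists M : 'I_m -> 'M[P]_n,
  [/\ forall l, alternating_mx (M l),
      forall l, hmx (fun i => - u1 i) (fun j => u1 j - u2 l) (M l) &
      forall a i j,
        \sum_l X a l * M l i j = (g 0 i *+ (a == j) - g 0 j *+ (a == i))].
Proof.
have [M [Malt ME]] := product11 gX.
exists (fun l => hcompmx (fun i => - u1 i) (fun j => u1 j - u2 l) (M l)).
split=> [l|l|a i j]; last 2 first.
- exact: hcompmxP.
- under eq_bigr => l _.
    rewrite mxE -(hcompM _ _ (hX a l)).
    rewrite (_ : _ + _ = u1 i + u1 j - u1 a); last by ring.
    over.
  rewrite -raddf_sum /= ME hcomp_id //; apply: grD.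
    case: eqP => [->|_]; last by rewrite mulr0n; exact: gr0.
    by have := hg 0 i; rewrite addrK subr0.
  apply: grN; case: eqP => [->|_]; last by rewrite mulr0n; exact: gr0.
  by have := hg 0 j; rewrite subr0 addrAC subrr add0r.
- split=> [|i]; last by rewrite mxE (Malt l).2 raddf0.
  apply/matrixP=> i j; rewrite !mxE -[RHS]raddfN /=.
  have /matrixP/(_ i j) := (Malt l).1; rewrite !mxE => ->.
  by congr (hcomp _ _); ring.
Qed.

Section WithProduct.
Variable M : 'I_m -> 'M[P]_n.
Hypothesis Malt : forall l, alternating_mx (M l).
Hypothesis Mh : forall l, hmx (fun i => - u1 i) (fun j => u1 j - u2 l) (M l).
Hypothesis ME : forall a i j,
  \sum_l X a l * M l i j = (g 0 i *+ (a == j) - g 0 j *+ (a == i)).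

Lemma homog_product12 : exists (T : 'M[P]_(n, m)) (T' : 'M[P]_(m, n)),
  [/\ forall l, h l 0 *: T = g^T *m delta_mx 0 l - M l *m X,
      T *m h = g^T & T *m T' = 1%:M].
Proof.
have [T0 T0E] := product12 gX Xh ME.
pose T := hcompmx (fun i => b - u1 i) u2 T0.
have TE l : h l 0 *: T = g^T *m delta_mx 0 l - M l *m X.
  have <- : hcompmx (fun i => u2 l - u1 i) u2 (h l 0 *: T0) = h l 0 *: T.
    rewrite (hcompmxZ _ _ _ (hh l 0)); congr (_ *: _); apply/matrixP=> i j.
    by rewrite !mxE; congr (hcomp _ _); ring.
  rewrite T0E hcompmx_id //; apply: hmxD.
    move=> i j; rewrite !mxE big_ord1 !mxE eqxx /=; case: eqP => [->|_].
      by rewrite mulr1 opprB addrC subrK; have := hg 0 i; rewrite subr0.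
    by rewrite mulr0; exact: gr0.
  apply: hmxN; apply: hmxM hX.
  by apply: hmx_eq (Mh l) => i j; ring.
have Th : T *m h = g^T := product12_last Xh h0 TE.
(* Perfectness of the pairing: [U] is inverse to [T^T] up to [X] on either side, and [X] has no
   constant terms, so [T] is invertible at the origin. *)
have [U UE] := last_syzygy_in_ideal gX Xh gXt Xht g0.
have [Z ZE] : exists Z, 1%:M - U *m T^T = X *m Z.
  apply: (exact_mxP gX); rewrite mulmxBr mulmx1 mulmxA UE -trmx_mul Th trmxK.
  by rewrite subrr.
have [Z' ZE'] : exists Z, (1%:M - U^T *m T)^T = X^T *m Z.
  apply: (exact_mxP Xht); rewrite -trmx_mul mulmxBl mul1mx -mulmxA Th.
  by rewrite -trmx_mul UE trmxK subrr trmx0.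
have UT : cst U *m cst T^T = 1%:M.
  apply/eqP; rewrite eq_sym -subr_eq0 -cstM -(map_mx1 (@mcoeff 3 k 0%MM)) -map_mxB.
  by rewrite ZE cstM X0 mul0mx.
have UtT : cst U^T *m cst T = 1%:M.
  apply/eqP; rewrite eq_sym -subr_eq0 -cstM -(map_mx1 (@mcoeff 3 k 0%MM)) -map_mxB.
  by rewrite -[1%:M - _]trmxK ZE' -map_trmx cstM -[cst X^T]map_trmx X0 trmx0 mul0mx trmx0.
have [|T' [_ TT' _]] := homog_inverse (hcompmxP _ _ T0) _ UtT.
  by apply: trmx_inj; rewrite trmx_mul !map_trmx trmxK trmx1.
by exists T, T'.
Qed.

Variables (s e : nat) (f : P) (dl : 'I_s -> int) (C : 'M[P]_(n, s)) (u : 'rV[P]_s).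
Hypotheses (f0 : f != 0) (fe : gr e%:Z f) (hC : hmx u1 dl C).
Hypothesis gC : g *m C = f *: u.

(** As [h], [M], [C] and [f] are homogeneous, the defining equation survives taking components;
    [Psi i j] has degree [dl i + dl j - b]. *)
Lemma homog_psi : exists (Psi : 'M[P]_s) (W : 'I_m -> 'M[P]_s),
  [/\ alternating_mx Psi, hmx (fun i => b - dl i) dl Psi &
      forall l, h l 0 *: Psi = C^T *m M l *m C - f *: W l].
Proof.
have [Psi0 [W0 [Psialt PsiE]]] := psi_exists gX Xh Malt ME gC.
exists (hcompmx (fun i => b - dl i) dl Psi0).
exists (fun l => hcompmx (fun i => u2 l - dl i + e%:Z) dl (W0 l)); split.
- split=> [|i]; last by rewrite mxE Psialt.2 raddf0.
  apply/matrixP=> i j; rewrite !mxE -[RHS]raddfN /=.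
  have /matrixP/(_ i j) := Psialt.1; rewrite !mxE => ->.
  by congr (hcomp _ _); ring.
- exact: hcompmxP.
move=> l; have <- : hcompmx (fun i => u2 l - dl i) dl (h l 0 *: Psi0) =
    h l 0 *: hcompmx (fun i => b - dl i) dl Psi0.
  rewrite (hcompmxZ _ _ _ (hh l 0)); congr (_ *: _); apply/matrixP=> i j.
  by rewrite !mxE; congr (hcomp _ _); ring.
rewrite PsiE -(hcompmxZ _ _ _ fe) -scaleN1r hcompmxD; congr (_ + _).
  rewrite hcompmx_id //; apply: (hmxM (u := fun j => u1 j)) hC.
  apply: (hmxM (u := fun j => u2 l - u1 j)).
    by apply: hmx_eq (hmx_tr hC) => i j; ring.
  by apply: hmx_eq (Mh l) => i j; ring.
by apply/matrixP=> i j; rewrite !mxE !mulN1r raddfN.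
Qed.

End WithProduct.
End GradedAlgebra.

(** * The matrix factorization *)

(** Over the field of fractions [B] divided by [f] is a two-sided inverse of [A]. *)
Lemma scalar_product_size (S : idomainType) p q (f : S) (A : 'M[S]_(p, q))
    (B : 'M[S]_(q, p)) :
  f != 0 -> A *m B = f%:M -> B *m A = f%:M -> p = q.
Proof.
move=> f0; have le p' q' (A' : 'M[S]_(p', q')) (B' : 'M[S]_(q', p')) :
    A' *m B' = f%:M -> (p' <= q')%N.
  move=> /(congr1 (map_mx (@tofrac S))); rewrite map_mxM map_scalar_mx /= => E.
  apply: (@mulmx1_min _ _ _ (map_mx (@tofrac S) A')
    ((tofrac f)^-1 *: map_mx (@tofrac S) B')).
  rewrite -scalemxAr E -scalemx1 scalerA mulVf ?scale1r //.
  by rewrite tofrac_eq0.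
by move=> /le AB /le BA; apply/anti_leq; rewrite AB BA.
Qed.

Section ResolutionModF.
Variables (S : idomainType) (n s r : nat) (f : S) (f0 : f != 0).
Variables (g : 'rV[S]_n) (C : 'M[S]_(n, s)) (u : 'rV[S]_s).
Variables (Phi : 'M[S]_(s, r)) (Y : 'M[S]_(n, r)).
Hypothesis gC : g *m C = f *: u.
Hypothesis Cgen : forall (y : 'cV_n) q, g *m y = f *: q ->
  exists v w, y = C *m v + f *: w.
Hypothesis CPhi : C *m Phi = f *: Y.
Hypothesis Phigen : forall v y : 'cV_ _, C *m v = f *: y -> exists w, v = Phi *m w.

(** In a relation between [g] and [f] the upper part comes from [C] and [f%:M] by [Cgen]; cancelling
    [f] then determines the lower part. *)
Lemma resolution_mod_exact1 :
  exact_mx (row_mx g f%:M) (block_mx C f%:M (- u) (- g)).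
Proof.
split=> [|v].
  rewrite mul_row_block gC !mul_scalar_mx mul_mx_scalar !scalerN !subrr.
  exact: row_mx0.
rewrite -[v]vsubmxK mul_row_col mul_scalar_mx => /eqP.
rewrite addr_eq0 -scalerN => /eqP gv; have [x [w vE]] := Cgen gv.
exists (col_mx x w); rewrite mul_block_col mul_scalar_mx -vE; congr col_mx.
apply/oppr_inj/(scalemxI f0); rewrite -gv vE mulmxDr mulmxA gC -scalemxAl -scalemxAr.
by rewrite -scalerDr !mulNmx -opprD opprK.
Qed.

Lemma resolution_mod_exact2 :
  exact_mx (block_mx C f%:M (- u) (- g)) (col_mx Phi (- Y)).
Proof.
split=> [|v].
  rewrite mul_block_col mul_scalar_mx CPhi scalerN subrr !mulNmx mulmxN opprK.
  rewrite (_ : - _ + _ = 0) ?col_mx0 //; apply: (scalemxI f0).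
  by rewrite scalerDr scalerN scalemxAl -gC scalemxAr -CPhi mulmxA addNr scaler0.
rewrite -[v]vsubmxK mul_block_col mul_scalar_mx -col_mx0 => /eq_col_mx[/eqP + _].
rewrite addr_eq0 -scalerN => /eqP Cv; have [z zE] := Phigen Cv.
exists z; rewrite mul_col_mx -zE; congr col_mx; apply/oppr_inj/(scalemxI f0).
by rewrite -Cv zE mulmxA CPhi mulNmx opprK scalemxAl.
Qed.

End ResolutionModF.

Section GradedFactorization.
Variable k : fieldType.
Local Notation P := {mpoly k[3]}.
Local Notation gr := (@poly_gr k).
Local Notation hmx := (homogeneous_mx gr).
Local Notation cst := (map_mx (@mcoeff 3 k 0%MM)).

Variables (n m s e : nat) (b : int) (f : P) (dl : 'I_s -> int).
Variables (g : 'rV[P]_n) (X : 'M[P]_(n, m)) (h : 'cV[P]_m).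
Hypotheses (f0 : f != 0) (fe : gr e%:Z f) (g0 : g != 0).
Hypotheses (gX : exact_mx g X) (Xh : exact_mx X h).
Hypotheses (gXt : exact_mx X^T g^T) (Xht : exact_mx h^T X^T).
Variables (M : 'I_m -> 'M[P]_n) (T : 'M[P]_(n, m)) (T' : 'M[P]_(m, n)).
Hypothesis TE : forall l, h l 0 *: T = g^T *m delta_mx 0 l - M l *m X.
Hypotheses (Th : T *m h = g^T) (TT' : T *m T' = 1%:M).
Variables (C : 'M[P]_(n, s)) (u : 'rV[P]_s).
Hypothesis gC : g *m C = f *: u.
Hypothesis Cgen : forall (y : 'cV_n) q, g *m y = f *: q ->
  exists v w, y = C *m v + f *: w.
Hypothesis Cmin : forall v y : 'cV_ _, C *m v = f *: y -> cst v = 0.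
Variables (Psi : 'M[P]_s) (W : 'I_m -> 'M[P]_s).
Hypotheses (Psialt : alternating_mx Psi) (Psih : hmx (fun i => b - dl i) dl Psi).
Hypothesis PsiE : forall l, h l 0 *: Psi = C^T *m M l *m C - f *: W l.
Variables (r0 : nat) (t0 : 'I_r0 -> int) (D0 : 'M[P]_(s, r0)) (Y0 : 'M[P]_(n, r0)).
Hypotheses (hD0 : hmx dl t0 D0) (CD0 : C *m D0 = f *: Y0).
Hypothesis D0gen : forall v y : 'cV_ _, C *m v = f *: y -> exists w, v = D0 *m w.

Lemma phi_exists : exists Phi : 'M[P]_s,
  [/\ alternating_mx Phi, hmx dl (fun i => b - dl i + e%:Z) Phi,
      Phi *m Psi = f%:M, Psi *m Phi = f%:M &
      (exists Y, C *m Phi = f *: Y) /\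
      forall v y : 'cV_ _, C *m v = f *: y -> exists w, v = Phi *m w].
Proof.
have [r [t [Phi0 [hPhi0 [A D0E] [B Phi0E] Phi0min]]]] := minimal_homog_generators hD0.
have Phi0gen (v y : 'cV_ _) : C *m v = f *: y -> exists w, v = Phi0 *m w.
  by move=> /D0gen[w ->]; exists (A *m w); rewrite D0E mulmxA.
have CPhi0 : C *m Phi0 = f *: (Y0 *m B) by rewrite Phi0E mulmxA CD0 scalemxAl.
(* With the block [- (Y0 *m B)] below it, [Phi0] is the third map of an exact complex, and its
   relations have no units, so Hilbert's syzygy theorem makes it injective. The lower block vanishes
   wherever [Phi0] does. *)
have Phi0inj p (Z : 'M_(r, p)) : Phi0 *m Z = 0 -> Z = 0.
  move=> PZ; apply/matrixP=> i j; rewrite mxE.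
  have : col j Z = 0; last by move=> /colP/(_ i); rewrite !mxE.
  apply: (third_syzygy_inj (resolution_mod_exact1 f0 gC Cgen)
    (resolution_mod_exact2 f0 gC CPhi0 Phi0gen)).
    move=> v; rewrite mul_col_mx -col_mx0 => /eq_col_mx[+ _].
    exact: Phi0min.
  have Pj : Phi0 *m col j Z = 0 by rewrite colE mulmxA PZ mul0mx.
  rewrite mul_col_mx Pj mulNmx; suff -> : Y0 *m B *m col j Z = 0.
    by rewrite oppr0 col_mx0.
  by apply: (scalemxI f0); rewrite scalemxAl -CPhi0 -mulmxA Pj mulmx0 scaler0.
have [Psi0 fE] : exists Psi0, f%:M = Phi0 *m Psi0.
  apply: mx_factor_cols => j; apply: (Phi0gen _ (col j C)).
  by rewrite colE mul_scalar_mx colE -scalemxAr.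
have Psi0Phi0 : Psi0 *m Phi0 = f%:M.
  apply/eqP; rewrite -subr_eq0; apply/eqP/Phi0inj.
  by rewrite mulmxBr mulmxA -fE mul_scalar_mx mul_mx_scalar subrr.
have rs : r = s by apply/esym/(scalar_product_size f0 (esym fE)).
have [E PsiE0] := psi_of_C f0 g0 gX gXt Th PsiE CPhi0.
have PsiEE : Psi = E *m Psi0.
  apply: (scalemxI f0); rewrite scalemxAl -PsiE0 -mulmxA -fE.
  by rewrite mul_mx_scalar.
(* Each row of [Psi0] sends the relation module, spanned by [Phi0], into multiples of [f], so
   [functional_psi] applies. *)
have [H [H' HE]] : exists (H : 'M_(r, s)) H', Psi0 = H *m Psi + f *: H'.
  suff /fin_all_exists[w /fin_all_exists[x wx]] : forall i,
      exists w t, row i Psi0 = w *m Psi + f *: t.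
    exists (\matrix_(i, j) w i 0 j), (\matrix_(i, j) x i 0 j).
    apply/row_matrixP => i; rewrite wx linearD /= row_mul linearZ /=.
    by congr (_ *m _ + f *: _); apply/rowP=> j; rewrite !mxE.
  move=> i; apply: (functional_psi f0 g0 gX Xh gXt Xht TE Th TT' gC Cgen Psialt PsiE).
  move=> v y Cv; have [z ->] := Phi0gen _ _ Cv.
  exists (row i z); rewrite mulmxA -row_mul Psi0Phi0.
  by rewrite -row_mul mul_scalar_mx linearZ.
(* Multiply [HE] by [Phi0] and cancel [f]. Since [Phi0] has no constant terms, [E] will be
   invertible at the origin. *)
have HE1 : H *m E + H' *m Phi0 = 1%:M.
  apply: (scalemxI f0); rewrite scalemx1 -Psi0Phi0 {1}HE mulmxDl -mulmxA PsiE0.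
  by rewrite scalerDr scalemxAr scalemxAl.
have cPhi0 : cst Phi0 = 0.
  apply/matrixP=> i j; have /Cmin/matrixP/(_ i 0) : C *m col j Phi0 = f *: col j (Y0 *m B).
    by rewrite [col j Phi0]colE mulmxA CPhi0 -scalemxAl -colE.
  by rewrite !mxE.
have cHE : cst H *m cst E = 1%:M.
  by rewrite -(map_mx1 (@mcoeff 3 k 0%MM)) -HE1 map_mxD !cstM cPhi0 mulmx0 addr0.
clear A D0E Phi0E Phi0min hPhi0 HE HE1 PsiEE.
subst r.
have cdE : (\det E)@_0%MM != 0.
  rewrite det_cst; apply: contraTneq (oner_neq0 k) => dE.
  by rewrite -(det1 k s) -cHE det_mulmx dE mulr0 eqxx.
have hf : hmx (fun i => b - dl i) (fun i => b - dl i + e%:Z) (f%:M : 'M_s).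
  have H1 := hmxZ fe (hmx1 k (fun i : 'I_s => b - dl i + e%:Z)).
  by rewrite -scalemx1; refine (hmx_eq _ H1) => i j; ring.
(* [Phi0 *m \adj E] solves the equation for [Phi] up to the factor [\det E], which has non-zero
   constant term. *)
have [|Phi hPhi PsiPhi] := homog_factor_unit Psih hf cdE.
  exists (Phi0 *m \adj E); rewrite mulmxA PsiE0 -scalemxAl mul_mx_adj.
  by rewrite !scale_scalar_mx mulrC.
have PhiPsi := mulmx_scalar_comm f0 (esym PsiPhi).
exists Phi; split=> //.
(* [Phi^T *m Psi *m Phi] is both [f *: Phi^T] and [- f *: Phi]; it is alternating because [Psi] is,
   and [f] cancels. *)
- have PhiT : Phi^T = - Phi.
    apply: (scalemxI f0); rewrite -mul_mx_scalar PsiPhi mulmxA.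
    have -> : Phi^T *m Psi = - f%:M.
      by rewrite -[Psi]opprK -Psialt.1 mulmxN -trmx_mul -PsiPhi tr_scalar_mx.
    by rewrite mulNmx mul_scalar_mx scalerN.
  split=> // i; have := (alternating_quad Phi Psialt).2 i.
  rewrite -mulmxA -PsiPhi PhiT mul_mx_scalar scalerN !mxE => /eqP.
  by rewrite oppr_eq0 mulf_eq0 (negPf f0) => /eqP.
- have [y yE] := C_of_psi f0 g0 gX gXt TE Th TT' gC Cgen Psialt PsiE
    (v := Phi) (z := 1%:M) (etrans (esym PsiPhi) (esym (scalemx1 _ _))).
  split; first by exists y.
  move=> v x Cv; have [z zE] := psi_of_C f0 g0 gX gXt Th PsiE Cv.
  exists z; apply: (scalemxI f0).
  by rewrite -mul_scalar_mx -PhiPsi -mulmxA zE -scalemxAr.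
Qed.

End GradedFactorization.

(** * Socle degrees *)

Section SocleChase.
Variables (S : idomainType) (x y t : S).

Lemma koszul_relation m n (A B C : 'M[S]_(m, n)) :
  x *: (y *: C - t *: B) - y *: (x *: C - t *: A) + t *: (x *: B - y *: A) = 0.
Proof. by apply/matrixP=> l j; rewrite !mxE; ring. Qed.

Variables (a b r : nat) (D1 : 'rV[S]_a) (D2 : 'M[S]_(a, b)) (D3 : 'M[S]_(b, r)).
Hypotheses (ex12 : exact_mx D1 D2) (ex23 : exact_mx D2 D3) (reg : regular3 x y t).

(** The Koszul chase in reverse: if [c] vanishes modulo [(x, y, t)], then [b01] is a boundary modulo
    [(x, y)], next [a0] is one modulo [x], and cancelling [x] makes [z] a boundary. *)
Lemma socle_chase_inj p (z : 'M_(1, p)) a0 a1 b01 b02 b12 c c0 c1 c2 :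
  x *: z = D1 *m a0 -> x *: a1 - y *: a0 = D2 *m b01 ->
  x *: b12 - y *: b02 + t *: b01 = D3 *m c -> c = x *: c0 + y *: c1 + t *: c2 ->
  exists v, z = D1 *m v.
Proof.
have X0 := regular3_neq0 reg.
move=> zE abE bcE cE.
have /(regular3_mx3 reg)[U [V UV]] : t *: (b01 - D3 *m c2) =
    x *: (D3 *m c0 - b12) + y *: (D3 *m c1 + b02).
  rewrite !scalerBr [y *: _]scalerDr !scalemxAr.
  have : D3 *m c = D3 *m (x *: c0) + D3 *m (y *: c1) + D3 *m (t *: c2).
    by rewrite cE !mulmxDr.
  rewrite -bcE; move/(canRL (addKr _)) => ->.
  by apply/matrixP=> i j; rewrite !mxE; ring.
have D2b : D2 *m b01 = x *: (D2 *m U) + y *: (D2 *m V).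
  rewrite -(subrK (D3 *m c2) b01) UV !mulmxDr mulmxA ex23.1 mul0mx addr0.
  by rewrite !scalemxAr.
have /(regular3_mx2 reg)[v vE] : y *: (a0 + D2 *m V) = x *: (a1 - D2 *m U).
  rewrite scalerDr scalerBr; apply/eqP; rewrite eq_sym subr_eq.
  rewrite -addrA [_ *: (_ *m V) + _]addrC -D2b -abE addrC subrK.
  by apply/eqP.
exists v; apply: (scalemxI X0); rewrite zE scalemxAr -vE mulmxDr mulmxA ex12.1.
by rewrite mul0mx addr0.
Qed.

End SocleChase.

Section Socle.
Variable k : fieldType.
Local Notation P := {mpoly k[3]}.
Local Notation gr := (@poly_gr k).
Local Notation hmx := (homogeneous_mx gr).
Local Notation cst := (map_mx (@mcoeff 3 k 0%MM)).

Lemma gr_variable (i : 'I_3) : gr 1 ('X_i : P).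
Proof.
apply/poly_grP=> m; rewrite mcoeffX; have [<-|_] := eqVneq U_(i)%MM m.
  by rewrite mdeg1.
by rewrite eqxx.
Qed.

Variables (a b r : nat) (D1 : 'rV[P]_a) (D2 : 'M[P]_(a, b)) (D3 : 'M[P]_(b, r)).
Hypotheses (ex12 : exact_mx D1 D2) (ex23 : exact_mx D2 D3).

Variables (ta : 'I_a -> int) (tb : 'I_b -> int) (tr : 'I_r -> int).
Hypotheses (hD1 : hmx (fun=> 0) ta D1) (hD2 : hmx ta tb D2) (hD3 : hmx tb tr D3).
Variables (s : nat) (sg : 'I_s -> int) (z : 'rV[P]_s).
Hypothesis hz : hmx (fun=> 0) sg z.
Hypothesis zsoc : forall i : 'I_3, exists w, 'X_i *: z = D1 *m w.

(* [soc(P/im D1) = Tor_3(P/im D1, k)], with a shift of degrees by 3. *)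
Lemma socle_chase : exists c : 'M[P]_(r, s), hmx tr (fun j => sg j + 3) c /\
  forall p (L : 'M[k]_(s, p)), cst c *m L = 0 ->
  exists y, z *m map_mx (@mpolyC 3 k) L = D1 *m y.
Proof.
have hXM i m n (t : 'I_m -> int) (u : 'I_n -> int) (A : 'M[P]_(m, n)) :
    hmx t u A -> hmx t (fun j => u j + 1) ('X_i *: A).
  move=> hA; refine (hmx_eq _ (hmxZ (gr_variable i) hA)) => l j; ring.
(* Each of the three lifting steps multiplies by one more variable, hence the total shift by 3. *)
pose sg1 j := sg j + 1; pose sg2 j := sg1 j + 1; pose sg3 j := sg2 j + 1.
have hXz i : exists2 w, hmx ta sg1 w & 'X_i *: z = D1 *m w.
  apply: (homog_factor hD1 _ (zsoc i)).
  exact: hXM.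
pose i0 := @Ordinal 3 0 isT; pose i1 := @Ordinal 3 1 isT; pose i2 := @Ordinal 3 2 isT.
have [a0 ha0 za0] := hXz i0; have [a1 ha1 za1] := hXz i1.
have [a2 ha2 za2] := hXz i2.
have step i j A B : hmx ta sg1 A -> hmx ta sg1 B ->
    'X_i *: z = D1 *m A -> 'X_j *: z = D1 *m B ->
    exists2 w, hmx tb sg2 w & 'X_i *: B - 'X_j *: A = D2 *m w.
  move=> hA hB zA zB; apply: (homog_factor hD2).
    by apply: hmxD; [|apply: hmxN]; apply: hXM.
  apply: (exact_mxP ex12); rewrite mulmxBr -!scalemxAr -zA -zB !scalerA.
  by rewrite mulrC subrr.
have [b01 hb01 E01] := step _ _ _ _ ha0 ha1 za0 za1.
have [b02 hb02 E02] := step _ _ _ _ ha0 ha2 za0 za2.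
have [b12 hb12 E12] := step _ _ _ _ ha1 ha2 za1 za2.
have [||c hc cE] := @homog_factor k _ _ _ tb tr sg3 D3
    ('X_i0 *: b12 - 'X_i1 *: b02 + 'X_i2 *: b01) hD3.
- by apply: hmxD; [apply: hmxD; [|apply: hmxN]|]; apply: hXM.
- apply: (exact_mxP ex23); rewrite mulmxDr mulmxBr -!scalemxAr -E01 -E02 -E12.
  exact: koszul_relation.
exists c; split; first by apply: hmx_eq hc => l j; rewrite /sg3 /sg2 /sg1; ring.
move=> p L cL; pose L' := map_mx (@mpolyC 3 k) L.
have /irrelevant3_mx[c0 [c1 [c2 cE']]] : cst (c *m L') = 0.
  rewrite cstM; have -> : cst L' = L; last exact: cL.
  by apply/matrixP=> l j; rewrite !mxE mcoeffC eqxx mulr1.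
apply: (@socle_chase_inj _ _ _ _ _ _ _ _ _ _ ex12 ex23 (variables_regular3 k)
  _ (z *m L') (a0 *m L') (a1 *m L') (b01 *m L') (b02 *m L')
  (b12 *m L') (c *m L')).
- by rewrite scalemxAl za0 mulmxA.
- by rewrite !scalemxAl -mulmxBl E01 mulmxA.
- by rewrite !scalemxAl -mulmxBl -mulmxDl cE mulmxA.
- exact: cE'.
Qed.

End Socle.

(** * The resolution of a Gorenstein ideal of grade three *)

Lemma exact_mx_of_iff (S : comPzRingType) a b c (D : 'M[S]_(a, b)) (D' : 'M[S]_(b, c)) :
  (forall v : 'cV_b, D *m v = 0 <-> exists w, v = D' *m w) -> exact_mx D D'.
Proof.
move=> ex; split=> [|v /ex //]; apply/matrixP=> i j.
have /ex/colP/(_ i) : exists w, col j D' = D' *m w by exists (delta_mx j 0); rewrite colE.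
by rewrite colE mulmxA -colE !mxE.
Qed.

Section RegularSequence.
Variable S : idomainType.

Lemma ideal_gen1 (x q : S) : ideal_gen (fun w => w \in [:: x]) q <-> exists t, q = x * t.
Proof.
split=> [[n [c [y [yx ->]]]]|[t ->]]; last first.
  exists 1%N, (fun=> t), (fun=> x); split=> [_|]; first by rewrite inE.
  by rewrite big_ord1 mulrC.
exists (\sum_i c i); rewrite mulr_sumr; apply: eq_bigr => i _.
by move: (yx i); rewrite inE => /eqP->; rewrite mulrC.
Qed.

Lemma ideal_gen2 (x y q : S) :
  ideal_gen (fun w => w \in [:: x; y]) q <-> exists t u, q = x * t + y * u.
Proof.
split=> [[n [c [z [zxy ->]]]]|[t [u ->]]]; last first.
  exists 2%N, (fun i => if i == 0 then t else u), (fun i => if i == 0 then x else y).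
  split=> [i|]; first by case: ifP; rewrite !inE eqxx ?orbT.
  by rewrite big_ord_recl big_ord1 /= mulrC [u * _]mulrC.
exists (\sum_(i | z i == x) c i), (\sum_(i | z i != x) c i).
rewrite (bigID (fun i => z i == x)) /= !mulr_sumr; congr (_ + _).
  by apply: eq_bigr => i /eqP->; rewrite mulrC.
apply: eq_bigr => i zx; move: (zxy i); rewrite !inE (negPf zx) /= => /eqP->.
by rewrite mulrC.
Qed.

Lemma regular_sequence3 (I : S -> Prop) : has_grade I 3 ->
  exists x y z, [/\ I x, I y, I z & regular3 x y z].
Proof.
case=> _ [q [qsize qI [reg _]]] _.
case: q => [|x [|y [|z [|? ?]]]] // in qsize qI reg *.
exists x, y, z; split; try by apply: qI; rewrite !inE eqxx ?orbT.
split=> [|q r E|q r t E].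
- apply/eqP=> x0; have [|n [c [w [w0 /eqP]]]] := reg 0%N isT 1.
    by exists 0%N, (fun=> 0), (fun=> 0); rewrite big_ord0 /= x0 mul0r; split=> // -[].
  case: n => [|n] in c w w0 *; first by rewrite big_ord0 oner_eq0.
  by have := w0 ord0; rewrite in_nil.
- by apply/ideal_gen1/(reg 1%N isT)/ideal_gen1; exists r.
- by apply/ideal_gen2/(reg 2%N isT)/ideal_gen2; exists r, t.
Qed.

End RegularSequence.

Section GorensteinResolution.
Variable k : fieldType.
Local Notation P := {mpoly k[3]}.
Local Notation gr := (@poly_gr k).
Local Notation hmx := (homogeneous_mx gr).
Local Notation cst := (map_mx (@mcoeff 3 k 0%MM)).

Lemma irrelevant_mcoeff0 p : irrelevant_ideal gr p -> p@_0%MM = 0.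
Proof.
case=> n [c [y [yd ->]]]; rewrite raddf_sum big1 //= => i _.
have [d [d0 yi]] := yd i; rewrite rmorphM /= (gr_mcoeff0 yi) ?mulr0 //.
by apply/eqP=> de; rewrite de in d0.
Qed.

Lemma irrelevant_cst m n (M : 'M[P]_(m, n)) :
  (forall i j, irrelevant_ideal gr (M i j)) -> cst M = 0.
Proof. by move=> MI; apply/matrixP=> i j; rewrite !mxE irrelevant_mcoeff0. Qed.

Lemma cst_cols_eq0 m n (M : 'M[P]_(m, n)) :
  (forall v : 'cV_n, M *m v = 0 -> cst v = 0) -> M = 0 -> n = 0%N.
Proof.
case: n M => // n M inj M0; have /inj/colP/(_ 0) : M *m (delta_mx 0 0 : 'cV_n.+1) = 0 by rewrite M0 mul0mx.
by rewrite !mxE mcoeff1 eqxx => /eqP; rewrite oner_eq0.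
Qed.

(** The last module has rank one, so [h] is a column, and over the domain [P] its injectivity is
    expressed by [gd_h0]. *)
Record gorenstein_data (I : P -> Prop) (b : int) (n m : nat) (u1 : 'I_n -> int)
    (u2 : 'I_m -> int) (g : 'rV[P]_n) (X : 'M[P]_(n, m)) (h : 'cV[P]_m) : Prop := {
  gd_I : forall p, I p <-> exists w, p%:M = g *m w;
  gd_hg : hmx (fun=> 0) u1 g;
  gd_hX : hmx u1 u2 X;
  gd_hh : hmx u2 (fun=> b) h;
  gd_g0 : g != 0;
  gd_h0 : h != 0;
  gd_X0 : cst X = 0;
  gd_gX : exact_mx g X;
  gd_Xh : exact_mx X h;
  gd_gXt : exact_mx X^T g^T;
  gd_Xht : exact_mx h^T X^T
}.

Lemma dual_exact (I : P -> Prop) n m q (g : 'rV[P]_n) (X : 'M[P]_(n, m)) (h : 'M[P]_(m, q)) :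
  has_grade I 3 -> (forall p, I p <-> exists w, p%:M = g *m w) ->
  exact_mx g X -> exact_mx X h ->
  [/\ g != 0, exact_mx X^T g^T & exact_mx h^T X^T].
Proof.
move=> /regular_sequence3[x [y [z [/[swap] Iy + Iz reg]]]] IE gX Xh.
move=> /[dup] Ix /IE[wx xE]; move/IE: Iy => [wy yE]; move/IE: Iz => [wz zE].
have xI : exists w, g *m w = x%:M by exists wx.
have yI : exists w, g *m w = y%:M by exists wy.
have zI : exists w, g *m w = z%:M by exists wz.
split; last exact: (dual_exact2 gX Xh xI yI zI reg); last first.
  exact: (dual_exact1 gX Xh xI yI reg).
apply/eqP=> g0; have := regular3_neq0 reg; apply/negP; rewrite negbK.
by have /matrixP/(_ 0 0) := xE; rewrite g0 mul0mx !mxE mulr1n => ->.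
Qed.

Lemma gorenstein_data_of_length (I : P -> Prop) b n0 n1 n2 n3 n l
    (t0 : 'I_n0 -> int) (t1 : 'I_n1 -> int) (t2 : 'I_n2 -> int) (t3 : 'I_n3 -> int)
    (D0 : 'M[P]_(n0, n1)) (D1 : 'M[P]_(n1, n2)) (D2 : 'M[P]_(n2, n3)) :
  has_grade I 3 -> n0 = 1%N -> (forall i, t0 i = 0) ->
  (forall v : 'cV_n0, (forall i, I (v i 0)) <-> exists w, v = D0 *m w) ->
  exact_mx D0 D1 -> exact_mx D1 D2 ->
  (forall v : 'cV_n3, D2 *m v = 0 -> v = 0) ->
  hmx t0 t1 D0 -> hmx t1 t2 D1 -> hmx t2 t3 D2 ->
  cst D0 = 0 -> cst D1 = 0 -> cst D2 = 0 ->
  (n < 4)%N -> l = nth 0%N [:: n0; n1; n2; n3] n -> l = 1%N ->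
  (forall j, (n < j < 4)%N -> nth 0%N [:: n0; n1; n2; n3] j = 0%N) ->
  (n = 3%N -> forall i, t3 i = b) ->
  exists m1 m2 u1 u2 g X h, @gorenstein_data I b m1 m2 u1 u2 g X h.
Proof.
move=> Igr n01; subst n0; move=> t00 IE ex01 ex12 inj h0 h1 h2 c0 c1 c2.
have IE' p : I p <-> exists w, p%:M = D0 *m w.
  split=> [Ip|[w pw]]; first by apply/IE => i; rewrite !mxE !ord1 mulr1n.
  have /IE/(_ 0) : exists w, p%:M = D0 *m w by exists w.
  by rewrite mxE mulr1n.
have [g0 Xt ht] := dual_exact Igr IE' ex01 ex12.
(* A last module in position 0 contradicts [g != 0]. In position 1 or 2, exactness of the dual
   complex would factor the identity through [D0^T] or [D1^T], which have no constant terms. *)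
case: n => [|[|[|[|//]]]] _ /= -> l1 nE tb.
- by move: (nE 1%N isT) g0 => /= n1E; move: (D0); rewrite n1E => D; rewrite thinmx0 eqxx.
- have /= n2E := nE 2%N isT; subst n1 n2.
  have [|w wE] := Xt.2 1%:M; first by rewrite mulmx1 [D1]thinmx0 trmx0.
  move: wE => /(congr1 cst); rewrite cstM -map_trmx c0 trmx0 mul0mx => /matrixP/(_ 0 0).
  by rewrite !mxE mcoeff1 eqxx => /eqP; rewrite oner_eq0.
- have /= n3E := nE 3%N isT; subst n2 n3.
  have [|w wE] := ht.2 1%:M; first by rewrite mulmx1 [D2]thinmx0 trmx0.
  move: wE => /(congr1 cst); rewrite cstM -map_trmx c1 trmx0 mul0mx => /matrixP/(_ 0 0).
  by rewrite !mxE mcoeff1 eqxx => /eqP; rewrite oner_eq0.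
subst n3; exists n1, n2, t1, t2, D0, D1, D2; split=> //.
- by move=> i j; rewrite -(t00 i); apply: h0.
- by move=> i j; rewrite -(tb erefl j); apply: h2.
- apply/eqP=> D20; have /matrixP/(_ 0 0) := inj 1%:M (etrans (congr1 (mulmx^~ _) D20) (mul0mx _ _)).
  by rewrite !mxE => /eqP; rewrite oner_eq0.
Qed.

Lemma gorenstein_data_exists (I : P -> Prop) b :
  has_grade I 3 -> back_twist gr I b ->
  exists m1 m2 u1 u2 g X h, @gorenstein_data I b m1 m2 u1 u2 g X h.
Proof.
move=> Igr [G [[[rk0 tw0] IE exG hG irr] [n [rkn twn rk_gt]]]].
have ex i : exact_mx (df G i) (df G i.+1) := exact_mx_of_iff (exG i).
have c i : cst (df G i) = 0 := irrelevant_cst (irr i).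
have cker i (v : 'cV_(rk G i.+1)) : df G i *m v = 0 -> cst v = 0.
  by move=> /(proj2 (ex i))[w ->]; rewrite cstM c mul0mx.
(* The third differential is injective, so by minimality all later modules vanish. *)
have inj2 := third_syzygy_inj (ex 0%N) (ex 1%N) (cker 2%N).
have rk4 i : rk G (4 + i) = 0%N.
  elim: i => [|i IHi]; apply: (cst_cols_eq0 (cker _)).
    apply/matrixP=> i j; have := inj2 (col j (df G 3)).
    rewrite colE mulmxA (ex 2%N).1 mul0mx => /(_ erefl).
    by rewrite -colE => /colP/(_ i); rewrite !mxE.
  by apply/matrixP=> i'; have := ltn_ord i'; rewrite {2}IHi.
have n4 : (n < 4)%N.
  by rewrite ltnNge; apply/negP=> n4; have := rk4 (n - 4)%N; rewrite subnKC // rkn.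
have rkE j : (j < 4)%N -> nth 0%N [:: rk G 0; rk G 1; rk G 2; rk G 3] j = rk G j.
  by case: j => [|[|[|[|]]]].
apply: (@gorenstein_data_of_length I b _ _ _ _ n (rk G n) (tw G 0%N) (tw G 1%N)
  (tw G 2%N) (tw G 3%N) (df G 0%N) (df G 1%N) (df G 2%N)) => //.
- by rewrite rkE.
- by move=> j /andP[nj j4]; rewrite rkE // rk_gt.
- by move=> n3; subst n; apply: twn.
Qed.

End GorensteinResolution.

Lemma unitmx_of_inj (K : fieldType) n (A : 'M[K]_n) :
  (forall v : 'cV_n, A *m v = 0 -> v = 0) -> A \in unitmx.
Proof.
move=> inj; rewrite -unitmx_tr -row_free_unit -kermx_eq0; apply/eqP/row_matrixP=> i.
rewrite row0; apply/trmx_inj; rewrite trmx0; apply: inj; apply: trmx_inj.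
by rewrite trmx_mul trmxK -row_mul mulmx_ker row0 trmx0.
Qed.

(** Exactness over the quotient by [f], expressed for lifted matrices. *)
Definition exact_mod (S : comPzRingType) a b c (f : S) (D : 'M[S]_(a, b)) (D' : 'M[S]_(b, c)) :=
  (exists E, D *m D' = f *: E) /\
  forall v : 'cV_b, (exists q, D *m v = f *: q) -> exists w t, v = D' *m w + f *: t.

Lemma exact_modP (S : comPzRingType) a b c f (D : 'M[S]_(a, b)) (D' : 'M[S]_(b, c)) :
  exact_mod f D D' -> forall p (V : 'M_(b, p)) q, D *m V = f *: q ->
  exists W T, V = D' *m W + f *: T.
Proof.
move=> [_ ex] p V q DV; apply: mx_factor_mod => j; apply: ex.
by exists (col j q); rewrite [col j V]colE mulmxA DV -scalemxAl -colE.
Qed.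

(** * Comparison of the matrix factorization with the given resolution *)

Section Core.
Variable k : fieldType.
Local Notation P := {mpoly k[3]}.
Local Notation gr := (@poly_gr k).
Local Notation hmx := (homogeneous_mx gr).
Local Notation cst := (map_mx (@mcoeff 3 k 0%MM)).
Local Notation inC := (map_mx (@mpolyC 3 k)).

Lemma cst1 n : cst (1%:M : 'M[P]_n) = 1%:M.
Proof. exact: map_mx1. Qed.

Lemma hmx_div m n d (t : 'I_m -> int) (u : 'I_n -> int) f A :
  f != 0 -> gr d f -> hmx t u (f *: A) -> hmx (fun i => t i + d) u A.
Proof.
move=> f0 fd hA; rewrite (_ : A = hcompmx (fun i => t i + d) u A).
  exact: hcompmxP.
by apply: (scalemxI f0); rewrite -(hcompmxZ _ _ _ fd) hcompmx_id.
Qed.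

Variables (I : P -> Prop) (b : int) (n m : nat) (u1 : 'I_n -> int) (u2 : 'I_m -> int).
Variables (g : 'rV[P]_n) (X : 'M[P]_(n, m)) (h : 'cV[P]_m).
Hypothesis gd : gorenstein_data I b u1 u2 g X h.
Variables (f : P) (e : nat).
Hypotheses (f0 : f != 0) (fe : gr e%:Z f) (fc : f@_0%MM = 0).
Variables (s r : nat) (v1 : 'I_n -> int) (v2 : 'I_s -> int) (v3 : 'I_r -> int).
Variables (d1 : 'rV[P]_n) (d2 : 'M[P]_(n, s)) (d3 : 'M[P]_(s, r)).
Hypotheses (hd1 : hmx (fun=> 0) v1 d1) (hd2 : hmx v1 v2 d2) (hd3 : hmx v2 v3 d3).
Hypotheses (c2 : cst d2 = 0) (c3 : cst d3 = 0).
Hypothesis d1g : forall j, exists w t, col j d1 = g *m w + f *: t.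
Hypothesis gd1 : forall j, exists w t, col j g = d1 *m w + f *: t.
Hypotheses (d12 : exact_mod f d1 d2) (d23 : exact_mod f d2 d3).
Hypothesis d3min : forall v : 'cV_r, (exists q, d3 *m v = f *: q) -> cst v = 0.

Lemma cst_mod a p (A : 'M[P]_(a, p)) B : A = f *: B -> cst A = 0.
Proof. by move=> ->; apply/matrixP=> i j; rewrite !mxE rmorphM /= fc mul0r. Qed.

(** [g] and [d1] span the same ideal modulo [f] and have the same length, so [V] is square; by
    [d12], [V0 *m V] is the identity up to [d2] and [f], which have no constant terms. *)
Lemma generators_change : exists V V', [/\ hmx u1 v1 V, V *m V' = 1%:M, V' *m V = 1%:M &
  exists Z, d1 = g *m V + f *: Z].
Proof.
have [V [Z [hV _ VE]]] := homog_factor_mod fe (gd_hg gd) hd1 (mx_factor_mod d1g).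
have [V0 [Z0 V0E]] := mx_factor_mod gd1.
have d1V0 : d1 *m V0 = g - f *: Z0 by rewrite [in RHS]V0E addrK.
have gV : g *m V = d1 - f *: Z by rewrite [in RHS]VE addrK.
have [|W [Y WE]] := exact_modP d12 (V := 1%:M - V0 *m V) (q := Z + Z0 *m V).
  rewrite mulmxBr mulmx1 mulmxA d1V0 mulmxBl gV -scalemxAl.
  by apply/matrixP=> i j; rewrite !mxE; ring.
have V0V : cst V0 *m cst V = 1%:M.
  apply/eqP; rewrite eq_sym -subr_eq0 -cstM -cst1 -map_mxB WE map_mxD cstM c2 mul0mx.
  by rewrite add0r (cst_mod erefl).
have [V' [_ VV' V'V]] := homog_inverse hV (mulmx1C V0V) V0V.
by exists V, V'; split=> //; exists Z.
Qed.

Variables (a : int) (sg : 'I_s -> int) (z : 'rV[P]_s).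
Hypothesis aE : a = e%:Z - 3.
Hypothesis hz : hmx (fun=> 0) sg z.
Hypothesis zsoc : forall i : 'I_3, exists w t, 'X_i *: z = g *m w + f *: t.
Hypothesis zind : forall L : 'cV[k]_s,
  (exists w t, z *m inC L = g *m w + f *: t) -> L = 0.
Hypothesis sgc : forall i j, sg i + sg j <> b + 2 * a.

Let t2 i := b + a - sg i.
Let t3 i := sg i + 3.

Lemma core_factorization : exists Phi Psi : 'M[P]_s, exists Q Q' : 'M[P]_s,
  exists (A : 'M[P]_(s, r)) (A' : 'M[P]_(r, s)),
  [/\ [/\ alternating_mx Phi, alternating_mx Psi, hmx t2 t3 Phi,
          hmx t3 (fun i => t2 i + e%:Z) Psi & cst Psi = 0],
      Phi *m Psi = f%:M /\ Psi *m Phi = f%:M,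
      [/\ hmx v2 t2 Q, hmx t2 v2 Q', Q *m Q' = 1%:M & Q' *m Q = 1%:M],
      [/\ hmx t3 v3 A, hmx v3 t3 A', A *m A' = 1%:M & A' *m A = 1%:M] &
      d3 = Q *m Phi *m A].
Proof.
have [V [V' [hV VV' V'V [Z d1V]]]] := generators_change.
pose C := V *m d2.
have hC : hmx u1 v2 C := hmxM hV hd2.
have [[E12 d12E] _] := d12; have [[E23 d23E] _] := d23.
have gV : g *m V = d1 - f *: Z by rewrite d1V addrK.
pose u := E12 - Z *m d2.
have gC : g *m C = f *: u.
  by rewrite mulmxA gV mulmxBl d12E -scalemxAl scalerBr.
have Cgen (y : 'cV_n) q : g *m y = f *: q -> exists v w, y = C *m v + f *: w.
  move=> gy; have [|w [t wt]] := d12.2 (V' *m y).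
    exists (q + Z *m V' *m y); rewrite d1V mulmxDl !mulmxA -(mulmxA g) VV' mulmx1 gy.
    by rewrite -!scalemxAl scalerDr.
  exists w, (V *m t); rewrite -[LHS]mul1mx -VV' -mulmxA wt mulmxDr mulmxA.
  by rewrite scalemxAr.
have Cker (v : 'cV_s) y : C *m v = f *: y -> exists w t, v = d3 *m w + f *: t.
  move=> Cv; apply: d23.2; exists (V' *m y).
  by rewrite -[d2]mul1mx -V'V -mulmxA -!mulmxA (mulmxA V) Cv scalemxAr.
have Cmin (v : 'cV_s) y : C *m v = f *: y -> cst v = 0.
  move=> /Cker[w [t ->]].
  by rewrite map_mxD cstM c3 mul0mx (cst_mod (B := t) erefl) addr0.
(* Over [P], the relation module of [C] is generated by the columns of [d3] and of [f%:M]. *)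
pose tD0 (j : 'I_(r + s)) := match split j with inl i => v3 i | inr i => v2 i + e%:Z end.
pose D0 := row_mx d3 (f%:M : 'M_s).
have hf (l : nat) (t : 'I_l -> int) : hmx t (fun i => t i + e%:Z) (f%:M : 'M_l).
  have H1 := hmxZ fe (hmx1 k (fun i : 'I_l => t i + e%:Z)).
  by rewrite -scalemx1; refine (hmx_eq _ H1) => i j; ring.
have hD0 : hmx v2 tD0 D0.
  apply: hmx_row_mx => i j; rewrite /tD0.
    by rewrite -[lshift _ _]/(unsplit (inl j)) unsplitK; apply: hd3.
  by rewrite -[rshift _ _]/(unsplit (inr j)) unsplitK; apply: hf.
have CD0 : C *m D0 = f *: row_mx (V *m E23) C.
  by rewrite mul_mx_row -mulmxA d23E -scalemxAr mul_mx_scalar scale_row_mx.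
have D0gen (v : 'cV_s) y : C *m v = f *: y -> exists w, v = D0 *m w.
  move=> /Cker[w [t ->]]; exists (col_mx w t).
  by rewrite mul_row_col mul_scalar_mx.
case: gd => gI hg hX hh g0 h0 X0 gX Xh gXt Xht.
have [M [Malt hM ME]] := homog_product11 hg hX gX.
have [T [T' [TE Th TT']]] := homog_product12 hg hX hh g0 h0 X0 gX Xh gXt Xht hM ME.
have [Psi1 [W [Psi1alt hPsi1 PsiE]]] := homog_psi hh gX Xh Malt hM ME fe hC gC.
have [Phi1 [Phi1alt hPhi1 PhiPsi1 PsiPhi1 [[Y CPhi] Phigen]]] :=
  phi_exists f0 fe g0 gX Xh gXt Xht TE Th TT' gC Cgen Cmin Psi1alt hPsi1 PsiE
    hD0 CD0 D0gen.
(* Degrees for the free resolution over [P] of the quotient by [I + (f)]. *)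
pose ta (j : 'I_(n + 1)) := match split j with inl i => u1 i | inr i => e%:Z end.
pose tb (j : 'I_(s + n)) := match split j with inl i => v2 i | inr i => u1 i + e%:Z end.
pose D1 := row_mx g (f%:M : 'M_1); pose D2 := block_mx C f%:M (- u) (- g).
pose D3 := col_mx Phi1 (- Y).
have splitl p q (i : 'I_p) : split (lshift q i) = inl i := unsplitK (inl i).
have splitr p q (i : 'I_q) : split (rshift p i) = inr i := unsplitK (inr i).
have hu : hmx (fun=> e%:Z) v2 u.
  apply: (@hmx_eq k _ _ (fun=> 0 + e%:Z) _ v2) => [i j|]; first by rewrite add0r.
  by apply: (hmx_div f0 fe); rewrite -gC; apply: hmxM hC.
have hY : hmx (fun i => u1 i + e%:Z) (fun i => b - v2 i + e%:Z) Y.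
  by apply: (hmx_div f0 fe); rewrite -CPhi; apply: hmxM hPhi1.
have hD1 : hmx (fun=> 0) ta D1.
  apply: hmx_row_mx => i j; rewrite /ta ?splitl ?splitr; first exact: hg.
  by have := hf 1%N (fun=> 0) i j; rewrite add0r.
have hD2 : hmx ta tb D2.
  move=> i j; rewrite /ta /tb; case: (split_ordP i) => l ->; case: (split_ordP j) => q ->.
  - by rewrite block_mxEul; apply: hC.
  - by rewrite block_mxEur; apply: hf.
  - by rewrite block_mxEdl mxE; apply: grN; rewrite ord1; apply: hu.
  - rewrite block_mxEdr mxE; apply: grN; rewrite addrK ord1.
    by have := hg 0 q; rewrite subr0.
have hD3 : hmx tb (fun i => b - v2 i + e%:Z) D3.
  move=> i j; rewrite /tb; case: (split_ordP i) => l ->.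
  - by rewrite col_mxEu; apply: hPhi1.
  - by rewrite col_mxEd mxE; apply: grN; apply: hY.
have ex1 := resolution_mod_exact1 f0 gC Cgen.
have ex2 := resolution_mod_exact2 f0 gC CPhi Phigen.
have [|c [hc cinj]] := socle_chase ex1 ex2 hD1 hD2 hD3 hz.
  move=> i; have [w [t ->]] := zsoc i; exists (col_mx w t).
  by rewrite mul_row_col mul_scalar_mx.
(* [c] is square because the rank of [F_2] equals the socle dimension; independence of the socle
   basis makes its constant part injective. *)
have cu : cst c \in unitmx.
  apply: unitmx_of_inj => L /cinj[y zL]; apply: zind.
  exists (usubmx y), (dsubmx y); rewrite zL -[in LHS](vsubmxK y).
  by rewrite mul_row_col mul_scalar_mx.
pose Q := inC (cst c); pose Q' := inC (invmx (cst c)).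
have QQ' : Q *m Q' = 1%:M by rewrite -map_mxM mulmxV // map_mx1.
have Q'Q : Q' *m Q = 1%:M by rewrite -map_mxM mulVmx // map_mx1.
have hQ : hmx v2 t2 Q.
  (* A non-zero constant term of [c i j] forces [v2 i = b + a - sg j]. *)
  move=> i j; rewrite !mxE; have [d0|d0] := eqVneq (t2 j - v2 i) 0.
    by rewrite d0; apply: grC.
  rewrite (gr_mcoeff0 (hc i j)) ?mpolyC0; first exact: gr0.
  apply: contra_neq d0 => E; apply/oppr_inj; rewrite oppr0 -[RHS]E /t2 aE; ring.
have hQ' : hmx t2 v2 Q'.
  rewrite (_ : Q' = hcompmx t2 v2 Q'); first exact: hcompmxP.
  rewrite -[RHS]mul1mx -Q'Q -mulmxA -(hcompmxMl _ _ hQ) QQ' hcompmx_id ?mulmx1 //.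
  exact: hmx1.
(* The base change is a congruence, so both matrices stay alternating. *)
pose Phi := Q' *m Phi1 *m Q'^T; pose Psi := Q^T *m Psi1 *m Q.
have Phialt : alternating_mx Phi.
  by have := alternating_quad Q'^T Phi1alt; rewrite trmxK.
have Psialt : alternating_mx Psi by exact: alternating_quad.
have QtQ't : Q'^T *m Q^T = 1%:M by rewrite -trmx_mul QQ' trmx1.
have PhiPsi : Phi *m Psi = f%:M.
  rewrite /Phi /Psi !mulmxA -(mulmxA _ _ Q^T) QtQ't mulmx1 -(mulmxA _ _ Psi1) PhiPsi1.
  by rewrite mul_mx_scalar -scalemxAl Q'Q scalemx1.
have PsiPhi := mulmx_scalar_comm f0 PhiPsi.
have hPhi : hmx t2 t3 Phi.
  apply: (hmxM (u := fun i => b - v2 i + e%:Z)); first exact: hmxM hQ' hPhi1.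
  by apply: hmx_eq (hmx_tr hQ') => i j; rewrite /t3 /t2 aE; ring.
have hPsi : hmx t3 (fun i => t2 i + e%:Z) Psi.
  have H : hmx (fun i => b - t2 i) t2 Psi.
    apply: (hmxM _ hQ); apply: (hmxM (u := fun i => b - v2 i)) hPsi1.
    by apply: hmx_eq (hmx_tr hQ) => i j; ring.
  by apply: hmx_eq H => i j; rewrite /t3 /t2 aE; ring.
have cPsi : cst Psi = 0.
  (* [Psi i j] has degree [b + 2 * a - sg i - sg j], which is non-zero by [sgc]. *)
  apply/matrixP=> i j; rewrite [LHS]mxE [RHS]mxE (gr_mcoeff0 (hPsi i j)) //.
  apply/eqP=> E; case: (@sgc i j); apply/esym/eqP; rewrite -subr_eq0 -E.
  by apply/eqP; rewrite /t2 /t3 aE; ring.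
have Phi1E : Phi1 = Q *m Phi *m Q^T.
  by rewrite /Phi !mulmxA QQ' mul1mx -mulmxA QtQ't mulmx1.
have QPhi : Q *m Phi = Phi1 *m Q'^T by rewrite /Phi !mulmxA QQ' mul1mx.
clearbody Phi Psi Q Q'.
have hQPhi : hmx v2 t3 (Q *m Phi) := hmxM hQ hPhi.
(* Modulo [f], [d3] and [Q *m Phi] generate the same module; [A] and [B] express each through the
   other. *)
have [A hA d3A] : exists2 A, hmx t3 v3 A & d3 = Q *m Phi *m A.
  apply: (homog_factor hQPhi hd3).
  have [|B BE] := @mx_factor_cols P _ _ _ Phi1 d3.
    move=> j; apply: (Phigen _ (V *m col j E23)).
    by rewrite !colE /C !mulmxA -[V *m d2 *m d3]mulmxA d23E -scalemxAr -scalemxAl.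
  by exists (Q^T *m B); rewrite mulmxA -Phi1E.
have [B [B' BE]] : exists B B', Q *m Phi = d3 *m B + f *: B'.
  apply: mx_factor_mod => j; apply: (Cker _ (Y *m col j Q'^T)).
  by rewrite QPhi !colE !mulmxA CPhi -!scalemxAl.
have QPhiinj p (B0 : 'M_(s, p)) : Q *m Phi *m B0 = 0 -> B0 = 0.
  move=> QB; have PB : Phi *m B0 = 0.
    by rewrite -[LHS]mul1mx -Q'Q -mulmxA [Q *m _]mulmxA QB mulmx0.
  by apply: (scalemx_eq0_inv f0); rewrite -mul_scalar_mx -PsiPhi -mulmxA PB mulmx0.
have fE : f%:M = Q *m Phi *m (Psi *m Q').
  by rewrite -!mulmxA (mulmxA Phi) PhiPsi mul_scalar_mx -scalemxAr QQ' scalemx1.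
(* Since [Psi] has no constant terms, [A *m B] is the identity at the origin; minimality of [d3]
   gives the same for [B *m A]. *)
have AB : A *m B + Psi *m Q' *m B' = 1%:M.
  apply/eqP; rewrite -subr_eq0; apply/eqP/QPhiinj.
  rewrite mulmxBr mulmx1 mulmxDr [in X in _ - X]BE !mulmxA -d3A -[f *: B']mul_scalar_mx fE.
  by rewrite !mulmxA subrr.
have cAB : cst A *m cst B = 1%:M.
  by rewrite -cst1 -AB map_mxD !cstM cPsi !mul0mx addr0.
have cBA : cst B *m cst A = 1%:M.
  apply/eqP; rewrite eq_sym -subr_eq0 -cstM -cst1 -map_mxB; apply/eqP.
  apply/matrixP=> i j; rewrite [RHS]mxE.
  have /d3min/matrixP/(_ i 0) : exists q, d3 *m col j (1%:M - B *m A) = f *: q.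
    exists (col j (B' *m A)); rewrite !colE mulmxA mulmxBr mulmx1 [d3 *m _]mulmxA.
    have -> : d3 *m B = Q *m Phi - f *: B' by rewrite BE addrK.
    by rewrite [_ *m A]mulmxBl -d3A opprB addrCA subrr addr0 -!scalemxAl.
  by rewrite !mxE.
have [A' [hA' AA' A'A]] := homog_inverse hA cAB cBA.
by exists Phi, Psi, Q, Q', A, A'.
Qed.

End Core.

(** * Passage to the quotient ring *)

Lemma ideal_gen_row (S : comPzRingType) n (g : 'I_n -> S) x :
  ideal_gen (fun y => exists i, y = g i) x <->
  exists w : 'cV_n, x%:M = (\row_i g i) *m w.
Proof.
split=> [[m [c [y [/fin_all_exists[p yp] ->]]]]|[w xw]].
  exists (\col_i \sum_(l | p l == i) c l); apply/matrixP=> a b.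
  rewrite !ord1 !mxE mulr1n (partition_big p predT) //=; apply: eq_bigr => i _.
  rewrite !mxE mulr_sumr; apply: eq_bigr => l /eqP <-.
  by rewrite yp mulrC.
exists n, (fun i => w i 0), g; split=> [i|]; first by exists i.
have /matrixP/(_ 0 0) := xw; rewrite !mxE mulr1n => ->.
by apply: eq_bigr => i _; rewrite mxE mulrC.
Qed.

Lemma row_of_generators (S : comPzRingType) n0 n1 (J : S -> Prop) (D : 'M[S]_(n0, n1)) :
  n0 = 1%N ->
  (forall v : 'cV_n0, (forall i, J (v i 0)) <-> exists w, v = D *m w) ->
  exists d : 'rV[S]_n1, [/\ forall j, exists i, d 0 j = D i j,
    forall v : 'cV_n1, D *m v = 0 <-> d *m v = 0 &
    forall x, J x <-> exists w, x%:M = d *m w].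
Proof.
move=> n01; subst n0 => JE; exists D; split=> // [j|x]; first by exists 0.
split=> [Jx|[w xw]]; first by apply/JE => i; rewrite !mxE !ord1 mulr1n.
have /JE/(_ 0) : exists w, x%:M = D *m w by exists w.
by rewrite mxE mulr1n.
Qed.

Section MinimalNumber.
Variable k : fieldType.
Local Notation P := {mpoly k[3]}.
Local Notation cst := (map_mx (@mcoeff 3 k 0%MM)).
Variables (S : comPzRingType) (pi : {rmorphism P -> S}).
Hypothesis pi_surj : forall r, exists p, pi p = r.

Lemma map_mx_surj m n (M : 'M[S]_(m, n)) : exists M', M = map_mx pi M'.
Proof.
have [i j|M' ME] := @mx_entry_choose P m n (fun i j p => pi p = M i j).
  exact: pi_surj.
by exists (\matrix_(i, j) M' i j); apply/matrixP=> i j; rewrite !mxE ME.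
Qed.

(** Two generating families express each other through [A] and [B]; as the relations of [d] have no
    units, the composite on [d] is the identity at the origin, whence [n <= q]. *)
Lemma min_number_generatorsE (J : S -> Prop) n q (d : 'rV[S]_n) :
  (forall x, J x <-> exists w, x%:M = d *m w) ->
  (forall v : 'cV[P]_n, d *m map_mx pi v = 0 -> cst v = 0) ->
  min_number_generators J q -> q = n.
Proof.
move=> JE dmin [[g gJ] qmin]; apply/anti_leq/andP; split.
  apply: (qmin n (fun i => d 0 i)) => x; rewrite JE ideal_gen_row.
  by rewrite (_ : \row_i d 0 i = d) //; apply/rowP=> i; rewrite mxE.
have {}gJ x : J x <-> exists w, x%:M = (\row_i g i) *m w by rewrite gJ ideal_gen_row.
have colJ p (e : 'rV[S]_p) : (forall x, J x <-> exists w, x%:M = e *m w) ->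
    forall j, J (e 0 j).
  move=> eJ j; apply/eJ; exists (delta_mx j 0); rewrite -colE.
  by apply/matrixP=> a b; rewrite !mxE !ord1 mulr1n.
have fact p p' (e : 'rV[S]_p) (e' : 'rV[S]_p') :
    (forall x, J x <-> exists w, x%:M = e *m w) ->
    (forall x, J x <-> exists w, x%:M = e' *m w) -> exists W, e' = e *m W.
  move=> eJ e'J; apply: mx_factor_cols => j.
  have /eJ[w ew] := colJ _ _ e'J j; exists w; rewrite -ew.
  by apply/matrixP=> a b; rewrite !mxE !ord1 mulr1n.
have [A dA] := fact _ _ _ _ gJ JE; have [B gB] := fact _ _ _ _ JE gJ.
have [A' AE] := map_mx_surj A; have [B' BE] := map_mx_surj B.
apply: (@mulmx1_min _ _ _ (cst B') (cst A')).
apply/eqP; rewrite eq_sym -subr_eq0 -cstM -cst1 -map_mxB; apply/eqP.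
apply/matrixP=> i j; rewrite [RHS]mxE.
have /dmin/colP/(_ i) : d *m map_mx pi (col j (1%:M - B' *m A')) = 0.
  rewrite map_col map_mxB map_mx1 map_mxM -AE -BE colE mulmxA mulmxBr mulmx1.
  by rewrite mulmxA -gB -dA subrr mul0mx.
by rewrite !mxE.
Qed.

End MinimalNumber.

Section Quotient.
Variable k : fieldType.
Local Notation P := {mpoly k[3]}.
Local Notation gr := (@poly_gr k).
Local Notation hmx := (homogeneous_mx gr).
Local Notation cst := (map_mx (@mcoeff 3 k 0%MM)).
Variables (f : P) (R : comPzRingType) (pi : {rmorphism P -> R}).
Hypothesis R_def : is_quotient_map pi (ideal_gen (fun p => p = f)).
Local Notation qgr := (quotient_gr gr pi).
Local Notation hmxq := (homogeneous_mx qgr).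

Lemma quotient_ker p : pi p = 0 <-> exists t, p = f * t.
Proof.
rewrite R_def.2; split=> [[n [c [y [yf ->]]]]|[t ->]].
  exists (\sum_i c i); rewrite mulr_sumr; apply: eq_bigr => i _.
  by rewrite yf mulrC.
by exists 1%N, (fun=> t), (fun=> f); rewrite big_ord1 mulrC.
Qed.

Lemma quotient_ker_mx m n (A : 'M[P]_(m, n)) :
  map_mx pi A = 0 <-> exists T, A = f *: T.
Proof.
split=> [/matrixP A0|[T ->]].
  have [i j|T TE] := @mx_entry_choose P m n (fun i j t => A i j = f * t).
    by apply/quotient_ker; have := A0 i j; rewrite !mxE.
  by exists (\matrix_(i, j) T i j); apply/matrixP=> i j; rewrite !mxE.
apply/matrixP=> i j; rewrite !mxE; apply/quotient_ker; by exists (T i j).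
Qed.

Lemma quotient_eq_mx m n (A B : 'M[P]_(m, n)) :
  map_mx pi A = map_mx pi B <-> exists T, A = B + f *: T.
Proof.
split=> [E|[T ->]].
  have /quotient_ker_mx[T TE] : map_mx pi (A - B) = 0 by rewrite map_mxB E subrr.
  by exists T; rewrite -TE addrC subrK.
by rewrite map_mxD (_ : map_mx pi (f *: T) = 0) ?addr0 //; apply/quotient_ker_mx; exists T.
Qed.

Lemma homog_lift m n t u (M : 'M[R]_(m, n)) : hmxq t u M ->
  exists2 M', hmx t u M' & M = map_mx pi M'.
Proof.
move=> hM; have [i j|M' ME] := @mx_entry_choose P m n
  (fun i j p => gr (u j - t i) p /\ M i j = pi p).
  by have [p] := hM i j; exists p.
exists (\matrix_(i, j) M' i j) => [i j|].
  by rewrite mxE; have [] := ME i j.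
by apply/matrixP=> i j; rewrite !mxE; have [] := ME i j.
Qed.

Lemma homog_map m n t u (M : 'M[P]_(m, n)) : hmx t u M -> hmxq t u (map_mx pi M).
Proof. by move=> hM i j; rewrite mxE; exists (M i j). Qed.

Lemma exact_mod_quotient a b c (D : 'M[P]_(a, b)) (D' : 'M[P]_(b, c)) :
  (forall v : 'cV_b, map_mx pi D *m v = 0 <-> exists w, v = map_mx pi D' *m w) ->
  exact_mod f D D'.
Proof.
move=> ex; split=> [|v [q Dv]].
  by apply/quotient_ker_mx; rewrite map_mxM; apply: (exact_mx_of_iff ex).1.
have /ex[w] : map_mx pi D *m map_mx pi v = 0.
  by rewrite -map_mxM; apply/quotient_ker_mx; exists q.
have [w' ->] := map_mx_surj R_def.1 w.
by rewrite -map_mxM => /quotient_eq_mx[t tE]; exists w', t.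
Qed.

Hypothesis fc : f@_0%MM = 0.

Lemma quotient_irrelevant p : irrelevant_ideal qgr (pi p) -> p@_0%MM = 0.
Proof.
case=> n [c [y [yd E]]].
have /fin_all_exists[y' y'E] : forall i, exists q, q@_0%MM = 0 /\ y i = pi q.
  move=> i; have [d [d0 [q qd ->]]] := yd i; exists q; split=> //.
  by apply: gr_mcoeff0 qd _; apply/eqP=> de; rewrite de in d0.
have /fin_all_exists[c' c'E] : forall i, exists q, pi q = c i.
  by move=> i; apply: R_def.1.
have /quotient_ker[t /(canRL (subrK _)) ->] : pi (p - \sum_i c' i * y' i) = 0.
  rewrite rmorphB rmorph_sum E -sumrB big1 // => i _.
  by rewrite rmorphM (y'E i).2 c'E subrr.
rewrite mcoeffD rmorphM /= fc mul0r add0r raddf_sum big1 //= => i _.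
by rewrite rmorphM /= (y'E i).1 mulr0.
Qed.

Lemma quotient_irrelevant_mx m n (M : 'M[P]_(m, n)) :
  (forall i j, irrelevant_ideal qgr (map_mx pi M i j)) -> cst M = 0.
Proof.
by move=> MI; apply/matrixP=> i j; rewrite !mxE; apply: quotient_irrelevant;
  have := MI i j; rewrite mxE.
Qed.

Lemma irrelevant_quotient d p : gr d p -> p@_0%MM = 0 -> irrelevant_ideal qgr (pi p).
Proof.
move=> pd p0; have [->|pn0] := eqVneq p 0.
  by rewrite rmorph0; exists 0%N, (fun=> 0), (fun=> 0); rewrite big_ord0; split=> // -[].
exists 1%N, (fun=> 1), (fun=> pi p); rewrite big_ord1 mul1r; split=> // _.
exists d; split; last by exists p.
case: d pd => [[|d]|d] pd //; last by rewrite pd eqxx in pn0.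
by move: pn0; rewrite -(hcomp_id pd) hcomp0 p0 mpolyC0 eqxx.
Qed.

Lemma quotient_extended (I : P -> Prop) p : is_ideal I ->
  extended_ideal pi I (pi p) <-> exists q t, I q /\ p = q + f * t.
Proof.
case=> I0 ID IM; split=> [[n [c [y [yI E]]]]|[q [t [Iq ->]]]]; last first.
  exists 1%N, (fun=> 1), (fun=> pi q); split=> [_|]; first by exists q.
  rewrite big_ord1 mul1r rmorphD (_ : pi (f * t) = 0) ?addr0 //.
  by apply/quotient_ker; exists t.
have /fin_all_exists2[y' y'I y'E] : forall i, exists2 q, I q & y i = pi q := yI.
have /fin_all_exists[c' c'E] : forall i, exists q, pi q = c i.
  by move=> i; apply: R_def.1.
have /quotient_ker[t tE] : pi (p - \sum_i c' i * y' i) = 0.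
  rewrite rmorphB rmorph_sum E -sumrB big1 // => i _.
  by rewrite rmorphM y'E c'E subrr.
exists (\sum_i c' i * y' i), t; split; last by rewrite -tE addrC subrK.
by apply: (big_ind I) => // i _; apply: IM.
Qed.

End Quotient.

(** Multiply by [B] and cancel [f]; used for both orders of the factors, this gives exactness of the
    periodic part over [R]. *)
Lemma matrix_factorization_exact (S : idomainType) p q r (f : S) (A : 'M[S]_(p, q))
    (B : 'M[S]_(q, p)) (v : 'M_(q, r)) x :
  f != 0 -> B *m A = f%:M -> A *m v = f *: x -> v = B *m x.
Proof.
move=> f0 BA Av; apply: (scalemxI f0).
by rewrite -mul_scalar_mx -BA -mulmxA Av scalemxAr.
Qed.

Theorem corollary3p1
  (k : fieldType)
  (f : {mpoly k[3]}) (e : nat) (f_neq0 : f != 0) (f_homog : f \is e.-homog)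
  (a : int) (a_def : a = e%:Z - 3)
  (R : comPzRingType) (pi : {rmorphism {mpoly k[3]} -> R})
  (R_def : is_quotient_map pi (ideal_gen (fun p => p = f)))
  (I : {mpoly k[3]} -> Prop)
  (I_homog : homogeneous_ideal (@poly_gr k) I)
  (I_grade : has_grade I 3)
  (I_gor : gorenstein_ideal I)
  (b : int) (b_def : back_twist (@poly_gr k) I b)
  (F : free_seq R)
  (F_res : minimal_graded_resolution (quotient_gr (@poly_gr k) pi) F
             (extended_ideal pi I))
  (s : nat) (sigma : 'I_s -> int)
  (sigma_def : socle_degrees (pi \o @mpolyC 3 k)
                 (quotient_gr (@poly_gr k) pi) (extended_ideal pi I) sigma)
  (hyp_a : exists n : nat, min_number_generators I n /\
             min_number_generators (extended_ideal pi I) n)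
  (hyp_b : rk F 2 = s)
  (hyp_c : forall i j : 'I_s, sigma i + sigma j <> b + 2 * a) :
  let t2 := fun i : 'I_s => b + a - sigma i in
  let t3 := fun i : 'I_s => sigma i + 3 in
  exists Phi Psi : 'M[{mpoly k[3]}]_s,
    [/\ alternating_mx Phi /\ alternating_mx Psi,
        homogeneous_mx (@poly_gr k) t2 t3 Phi,
        homogeneous_mx (@poly_gr k) t3 (fun i => t2 i + e%:Z) Psi,
        Phi *m Psi = f%:M /\ Psi *m Phi = f%:M &
        (* B2 and B3 are homogeneous bases of F_2 and F_3, with inverses C2, C3 *)
        exists (B2 : 'M[R]_(rk F 2, s)) (C2 : 'M[R]_(s, rk F 2))
               (B3 : 'M[R]_(rk F 3, s)) (C3 : 'M[R]_(s, rk F 3)),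
          [/\ graded_iso (quotient_gr (@poly_gr k) pi) (tw F 2) t2 B2 C2,
              graded_iso (quotient_gr (@poly_gr k) pi) (tw F 3) t3 B3 C3 &
              minimal_graded_resolution (quotient_gr (@poly_gr k) pi)
                (periodic_tail e%:Z
                   (B2 *m map_mx pi Phi *m C3) (B3 *m map_mx pi Psi *m C2))
                (extended_ideal pi I)]].
Proof.
case: I_homog => I_id _; set J := extended_ideal pi I in F_res sigma_def hyp_a *.
set qgr := quotient_gr (@poly_gr k) pi in F_res sigma_def *.
have [n [m [u1 [u2 [g [X [h gd]]]]]]] := gorenstein_data_exists I_grade b_def.
have fe : poly_gr e%:Z f by [].
have [q [I_q J_q]] := hyp_a.
have qn : q = n.
  apply: (min_number_generatorsE (pi := idfun) (d := g) _ (gd_I gd) _ I_q).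
    by move=> p; exists p.
  move=> v; rewrite map_mx_id // => gv.
  by have [w ->] := (gd_gX gd).2 _ gv; rewrite cstM (gd_X0 gd) mul0mx.
(* Otherwise the homogeneous [f] is a non-zero constant, [R] is zero and [J] needs no generators, so
   hypothesis (a) contradicts [g != 0]. *)
have fc : f@_0%MM = 0.
  have [e0|] := eqVneq e%:Z 0; last exact: gr_mcoeff0.
  have f_const : f = (f@_0%MM)%:MP by rewrite -hcomp0 -e0 hcomp_id.
  apply/eqP/contraT => fc0; move: (gd_g0 gd).
  have R0 (x : R) : x = 0.
    have [p <-] := R_def.1 x; apply/(quotient_ker R_def).
    exists ((f@_0%MM)^-1%:MP * p).
    by rewrite mulrA {1}f_const -mpolyCM mulfV // mul1r.
  suff n0 : n = 0%N by move: g {gd}; rewrite n0 => g; rewrite thinmx0 eqxx.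
  apply/eqP; rewrite -leqn0 -qn; apply: (J_q.2 0%N (fun=> 0)) => x.
  split=> _; last by rewrite (R0 x); exists 0%N, (fun=> 0), (fun=> 0); rewrite big_ord0; split=> // -[].
  by exists 0%N, (fun=> 0), (fun=> 0); rewrite big_ord0 (R0 x); split=> // -[].
case: F_res => [[F0 F0tw] F0J Fex Fh Firr].
have [d1r [d1D d1ker JE]] := row_of_generators F0 F0J.
have hd1r : homogeneous_mx qgr (fun=> 0) (tw F 1%N) d1r.
  move=> i j; rewrite ord1; have [l ->] := d1D j.
  by have := Fh 0%N l j; rewrite F0tw.
subst s.
have [d1 hd1 d1E] := homog_lift hd1r.
have [d2 hd2 d2E] := homog_lift (Fh 1%N).
have [d3 hd3 d3E] := homog_lift (Fh 2%N).
have cst_of N (D : 'M_(rk F N, rk F N.+1)) : df F N = map_mx pi D ->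
    map_mx (@mcoeff 3 k 0%MM) D = 0.
  by move=> DE; apply: (quotient_irrelevant_mx R_def fc); rewrite -DE; apply: Firr.
have kerF N (v : 'cV[{mpoly k[3]}]_(rk F N.+1)) : df F N *m map_mx pi v = 0 ->
    map_mx (@mcoeff 3 k 0%MM) v = 0.
  have [D DE] := map_mx_surj R_def.1 (df F N.+1).
  move=> /(Fex N)[w]; have [w' ->] := map_mx_surj R_def.1 w.
  rewrite DE -map_mxM => /(quotient_eq_mx R_def)[t ->].
  rewrite map_mxD cstM (cst_of _ _ DE) mul0mx add0r.
  exact: (cst_mod fc (erefl (f *: t))).
have nF : n = rk F 1.
  rewrite -qn; apply: (min_number_generatorsE R_def.1 JE _ J_q) => v.
  by move=> /d1ker; apply: kerF.
subst n q.
have memJ p : J (pi p) <-> exists w t, p%:M = g *m w + f *: t.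
  rewrite /J (quotient_extended R_def) //; split=> [[y [t [/(gd_I gd)[w gw] ->]]]|].
    by exists w, t%:M; rewrite -gw scale_scalar_mx raddfD.
  move=> [w [t pE]]; exists ((g *m w) 0 0), (t 0 0); split.
    by apply/(gd_I gd); exists w; rewrite [RHS]mx11_scalar.
  by have /matrixP/(_ 0 0) := pE; rewrite mxE mulr1n => ->; rewrite mxE [X in _ + X]mxE.
have colM p (r : 'rV[{mpoly k[3]}]_p) j : col j r = (r 0 j)%:M.
  by apply/matrixP=> x y; rewrite !mxE !ord1 mulr1n.
have d1g j : exists w t, col j d1 = g *m w + f *: t.
  rewrite colM; apply/memJ; apply/JE; exists (delta_mx j 0); rewrite -colE.
  by apply/matrixP=> x y; rewrite d1E !mxE !ord1 mulr1n.
have gd1 j : exists w t, col j g = d1 *m w + f *: t.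
  have /JE[w] : J (pi (g 0 j)).
    by apply/memJ; exists (delta_mx j 0), 0; rewrite -colM colE scaler0 addr0.
  have [w' ->] := map_mx_surj R_def.1 w.
  rewrite d1E -map_mxM -(map_scalar_mx pi) => /(quotient_eq_mx R_def)[t tE].
  by exists w', t; rewrite colM.
have d12 : exact_mod f d1 d2.
  apply: (exact_mod_quotient R_def) => v; rewrite -d1E -d2E -(Fex 0%N).
  by split=> /d1ker.
have d23 : exact_mod f d2 d3.
  by apply: (exact_mod_quotient R_def) => v; rewrite -d2E -d3E; apply: Fex.
have d3min (v : 'cV_(rk F 3)) : (exists y, d3 *m v = f *: y) ->
    map_mx (@mcoeff 3 k 0%MM) v = 0.
  move=> [y yE]; apply: kerF; rewrite d3E -map_mxM.
  by apply/(quotient_ker_mx R_def); exists y.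
have [z [zh zc zb]] := sigma_def.
have /fin_all_exists[zp zpE] : forall i, exists p, poly_gr (sigma i) p /\ z i = pi p.
  by move=> i; have [p ph pE] := zh i; exists p.
pose zr := \row_i zp i.
have hz : homogeneous_mx (@poly_gr k) (fun=> 0) sigma zr.
  by move=> i j; rewrite mxE subr0; have [] := zpE j.
have zsoc (i : 'I_3) : exists w t, 'X_i *: zr = g *m w + f *: t.
  apply: mx_factor_mod => j; rewrite colM; apply/memJ.
  rewrite !mxE mulrC rmorphM -(zpE j).2; apply: (zc j).
  apply: (irrelevant_quotient pi (gr_variable k i)).
  by rewrite mcoeffX; case: eqP => // /(congr1 mdeg); rewrite mdeg1 mdeg0.
have J0 : J 0 by exists 0%N, (fun=> 0), (fun=> 0); rewrite big_ord0; split=> // -[].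
have zind (L : 'cV[k]_(rk F 2)) :
    (exists w t, zr *m map_mx (@mpolyC 3 k) L = g *m w + f *: t) -> L = 0.
  (* Both [0] and [L^T] are coordinates of the zero class in the socle, and coordinates are
     unique. *)
  move=> [w [t zL]]; have [|c [_ cU]] := zb 0; first by move=> y _; rewrite mul0r.
  suff : 0 = L^T by move/(congr1 trmx); rewrite trmx0 trmxK.
  rewrite -(cU 0) ?(cU L^T) //; last first.
    by rewrite big1 ?subr0 // => i _; rewrite mxE /= mpolyC0 rmorph0 mul0r.
  rewrite (_ : 0 - _ = pi (- (zr *m map_mx (@mpolyC 3 k) L) 0 0)).
    apply/memJ; exists (- w), (- t); rewrite mulmxN scalerN -opprD -zL raddfN.
    by rewrite /= -mx11_scalar.
  rewrite sub0r rmorphN mxE rmorph_sum; congr (- _); apply: eq_bigr => i _.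
  by rewrite !mxE rmorphM -(zpE i).2 mulrC.
have [Phi [Psi [Q [Q' [A [A' [[Phia Psia hPhi hPsi cPsi] [PhiPsi PsiPhi]
    [hQ hQ' QQ' Q'Q] [hA hA' AA' A'A] d3A]]]]]]] :=
  core_factorization gd f_neq0 fe fc hd1 hd2 hd3 (cst_of 1%N _ d2E) (cst_of 2%N _ d3E)
    d1g gd1 d12 d23 d3min a_def hz zsoc zind hyp_c.
move=> t2 t3; exists Phi, Psi; split=> //.
have phiE : map_mx pi Q *m map_mx pi Phi *m map_mx pi A = df F 2.
  by rewrite d3E d3A !map_mxM.
(* In the given bases, [d3] and [psi] again form a matrix factorization of [f]. *)
pose psi := A' *m Psi *m Q'.
have psiE : map_mx pi A' *m map_mx pi Psi *m map_mx pi Q' = map_mx pi psi.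
  by rewrite !map_mxM.
have hpsi : homogeneous_mx (@poly_gr k) (tw F 3) (fun i => tw F 2%N i + e%:Z) psi.
  apply: (hmxM (u := fun i => t2 i + e%:Z)); first exact: hmxM hA' hPsi.
  by apply: hmx_eq hQ' => i j; rewrite /t2; ring.
have cpsi : map_mx (@mcoeff 3 k 0%MM) psi = 0 by rewrite !cstM cPsi mulmx0 mul0mx.
have d3psi : d3 *m psi = f%:M.
  rewrite d3A /psi !mulmxA -(mulmxA _ A) AA' mulmx1 -(mulmxA _ Phi) PhiPsi.
  by rewrite mul_mx_scalar -scalemxAl QQ' scalemx1.
have psid3 : psi *m d3 = f%:M.
  rewrite d3A /psi !mulmxA -(mulmxA _ Q') Q'Q mulmx1 -(mulmxA _ Psi) PsiPhi.
  by rewrite mul_mx_scalar -scalemxAl A'A scalemx1.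
have mf_ex p p' (B : 'M_(p, p')) B' (v : 'cV_p') : B *m B' = f%:M -> B' *m B = f%:M ->
    map_mx pi B *m v = 0 <-> exists w, v = map_mx pi B' *m w.
  move=> BB' B'B; split=> [|[w ->]].
    have [v' ->] := map_mx_surj R_def.1 v.
    rewrite -map_mxM => /(quotient_ker_mx R_def)[x xE].
    exists (map_mx pi x); rewrite -map_mxM; congr map_mx.
    exact: matrix_factorization_exact f_neq0 B'B xE.
  rewrite mulmxA -map_mxM BB'; have [w' ->] := map_mx_surj R_def.1 w.
  by rewrite -map_mxM mul_scalar_mx; apply/(quotient_ker_mx R_def); exists w'.
(* The equation [d3 = Q *m Phi *m A] dictates the bases: [Q] for [F_2] and the inverse [A'] of [A]
   for [F_3]. *)
exists (map_mx pi Q), (map_mx pi Q'), (map_mx pi A'), (map_mx pi A); split.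
- by split; [exact: homog_map|exact: homog_map|rewrite -map_mxM QQ' map_mx1|rewrite -map_mxM Q'Q map_mx1].
- by split; [exact: homog_map|exact: homog_map|rewrite -map_mxM A'A map_mx1|rewrite -map_mxM AA' map_mx1].
rewrite phiE psiE; split=> //.
- case=> [|[|N]]; [exact: (Fex 0%N)|exact: (Fex 1%N)|].
  by rewrite /= d3E; case: (odd N) => /= v; apply: mf_ex.
- case=> [|[|N]]; first exact: (Fh 0%N).
    by move=> i j /=; rewrite mul0r addr0; apply: Fh.
  (* For odd [N] the source of [psi] is a copy of [F_2] twisted once more than the target copy of
     [F_3], hence the extra [e]. *)
  move=> /=; rewrite uphalf_half; case: (odd N) => /= i j.
    rewrite (_ : _ - _ = tw F 2 j + e%:Z - tw F 3 i); last first.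
      by rewrite add1n intS; ring.
    by rewrite mxE; exists (psi i j); first exact: hpsi.
  rewrite (_ : _ - _ = tw F 3 j - tw F 2 i); last by rewrite add0n; ring.
  exact: Fh.
- case=> [|[|N]]; [exact: (Firr 0%N)|exact: (Firr 1%N)|].
  move=> /=; case: (odd N) => /= i j; last exact: Firr.
  rewrite mxE; apply: (irrelevant_quotient pi (hpsi i j)).
  by have /matrixP/(_ i j) := cpsi; rewrite !mxE.
Qed.
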